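(* Let $T$ be a tensor minimal over $X,Y,Z$ together with partitions $X=X_1\cup\dots\cup X_{k}$, $Y=Y_1\cup\dots\cup Y_{k}$, $Z=Z_1\cup\dots\cup Z_{k}$ forming a laser-ready tensor partition. For $p\in P^{sym}(L)$ let $A_p=\prod_{T_{ijk}\in L}|X_i|^{p(T_{ijk})}$ and $C_p=\prod_{i\in[k]}p(X_i)^{-p(X_i)}$ (the Laser Method applied with distribution $p$ shows the upper bound on $\omega$ given by the smallest $w$ with $C_p\cdot A_p^{w/2}\ge \tilde R(T)$). Suppose there is a real $c>2$ such that for every $p\in P^{sym}(L)$ and every $w<c$ we have $C_p\cdot A_p^{w/2}<\tilde R(T)$ (i.e., the Laser Method applied to $T$ with this partition yields a bound on $\omega$ no better than $c$). Then $\omega_u(T)>2$.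
   Context: All tensors are over a field $\mathbb{F}$. A tensor over finite variable sets $X,Y,Z$ is a trilinear form $\sum\alpha_{xyz}xyz$; it is minimal over $X,Y,Z$ if every variable appears in some term with nonzero coefficient. Tensor products, tensor powers $T^{\otimes n}$, direct sums, rank $R$, and asymptotic rank $\tilde R(T)=\liminf_n R(T^{\otimes n})^{1/n}$ are as usual; $\langle a,b,c\rangle=\sum_{i\in[a],j\in[b],k\in[c]}x_{ij}y_{jk}z_{ki}$. A degeneration of $T_1$ (over $X_1,Y_1,Z_1$) to $T_2$ (over $X_2,Y_2,Z_2$): substitute each variable of $T_1$ by a linear combination of variables of $T_2$ with coefficients polynomials in a formal variable $\lambda$; $T_2$ must be the coefficient of some $\lambda^h$ in the result, with all lower powers of $\lambda$ having zero coefficient. $\omega_u(T)$: for each $n$ and each degeneration of $T^{\otimes n}$ into $\bigoplus_{i=1}^m\langle a_i,b_i,c_i\rangle$, take $w$ with $\sum_i(a_ib_ic_i)^{w/3}=\tilde R(T)^n$; $\omega_u(T)$ is the infimum (liminf) of such $w$. Partition notation: $T_{ijk}$ is $T$ with all variables outside $X_i,Y_j,Z_k$ set to zero; $L=\{T_{ijk}:T_{ijk}\ne0\}$. For a probability distribution $p$ on $L$, $p(X_i)=\sum_{j,k:T_{ijk}\in L}p(T_{ijk})$. The rotation $rot(T)$ of $T$ over $X,Y,Z$ is the tensor over $Y,Z,X$ with coefficient of $y_jz_kx_i$ equal to that of $x_iy_jz_k$ in $T$; $T$ is variable-symmetric if $T\simeq rot(T)$ (equal up to renaming variables). The partitions are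 $T$-symmetric if they have equally many parts $k$, $|X_i|=|Y_i|=|Z_i|$ for all $i$, and $T_{jki}\simeq rot(T_{ijk})$ for all $i,j,k$. $P^{sym}(L)$ is the set of probability distributions $p$ on $L$ with $p(T_{ijk})=p(T_{jki})$ for all $i,j,k$. Laser-ready tensor partition: (1) for every $(i,j,k)$, either $T_{ijk}=0$ or $T_{ijk}$ has a degeneration to some $\langle a,b,c\rangle$ with $ab=|X_i|$, $bc=|Y_j|$, $ca=|Z_k|$ (indices of parts identified with $1,\dots,k$); (2) there is an integer $\ell$ such that $T_{ijk}\neq0$ only if $i+j+k=\ell$; (3) $T$ is variable-symmetric and the partitions are $T$-symmetric. *)

(* Defs.v *)
From mathcomp Require Import all_boot all_order all_algebra.
From mathcomp Require Import boolp classical_sets reals ereal topology sequences exp.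

Set Implicit Arguments.
Unset Strict Implicit.
Unset Printing Implicit Defensive.

Import Order.TTheory GRing.Theory Num.Theory.
Local Open Scope ring_scope.

Section Tensors.
Variable F : fieldType.

(* [T x y z] is the coefficient of the monomial xyz. *)
Definition tensor (X Y Z : finType) := X -> Y -> Z -> F.

Definition tensor_zero (X Y Z : finType) (T : tensor X Y Z) : bool :=
  [forall x, forall y, forall z, T x y z == 0].

Definition tensor_minimal (X Y Z : finType) (T : tensor X Y Z) : Prop :=
  [/\ forall x, exists y, exists z, T x y z != 0,
      forall y, exists x, exists z, T x y z != 0
    & forall z, exists x, exists y, T x y z != 0].

Definition tensor_pow (X Y Z : finType) (T : tensor X Y Z) (n : nat) :
    tensor {ffun 'I_n -> X} {ffun 'I_n -> Y} {ffun 'I_n -> Z} :=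
  fun x y z => \prod_(i < n) T (x i) (y i) (z i).

(* [untag 0 G v], for [G] on the i-th summand, applies [G] to the component of
   [v] if [tag v = i] and is 0 otherwise: monomials mixing different summands
   have coefficient 0. *)
Definition tensor_dsum (m : nat) (X Y Z : 'I_m -> finType)
    (T : forall i, tensor (X i) (Y i) (Z i)) :
    tensor {i : 'I_m & X i} {i : 'I_m & Y i} {i : 'I_m & Z i} :=
  fun u v w =>
    untag 0 (fun y : Y (tag u) =>
      untag 0 (fun z : Z (tag u) => T (tag u) (tagged u) y z) w) v.

Definition matmul_tensor (a b c : nat) :
    tensor ('I_a * 'I_b)%type ('I_b * 'I_c)%type ('I_c * 'I_a)%type :=
  fun x y z => ((x.2 == y.1) && (y.2 == z.1) && (z.2 == x.1))%:R.
Arguments matmul_tensor a b c _ _ _ : clear implicits.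

Definition rank_le (X Y Z : finType) (T : tensor X Y Z) (r : nat) : Prop :=
  exists (u : 'I_r -> X -> F) (v : 'I_r -> Y -> F) (w : 'I_r -> Z -> F),
    forall x y z, T x y z = \sum_(s < r) u s x * v s y * w s z.

Lemma rank_le_exists (X Y Z : finType) (T : tensor X Y Z) :
  exists r, `[< rank_le T r >].
Proof.
exists #|{: X * Y * Z}|; apply/asboolP.
exists (fun s x => T (enum_val s).1.1 (enum_val s).1.2 (enum_val s).2
                   * (x == (enum_val s).1.1)%:R),
  (fun s y => (y == (enum_val s).1.2)%:R), (fun s z => (z == (enum_val s).2)%:R).
move=> x y z; rewrite -(reindex enum_val (P := predT) (F := fun t : X * Y * Z =>
  T t.1.1 t.1.2 t.2 * (x == t.1.1)%:R * (y == t.1.2)%:R * (z == t.2)%:R)) /=; last first.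
  by apply: onW_bij; exact: enum_val_bij.
rewrite (bigD1 (x, y, z)) //= !eqxx !mulr1 big1 ?addr0 // => -[[x' y'] z'] /=.
rewrite !xpair_eqE (eq_sym x') (eq_sym y') (eq_sym z').
by case: (x == x'); case: (y == y'); case: (z == z') => //= _; rewrite ?mulr0 ?mul0r.
Qed.

Definition tensor_rank (X Y Z : finType) (T : tensor X Y Z) : nat :=
  ex_minn (rank_le_exists T).

Definition degenerates (X1 Y1 Z1 X2 Y2 Z2 : finType)
    (T1 : tensor X1 Y1 Z1) (T2 : tensor X2 Y2 Z2) : Prop :=
  exists (al : X1 -> X2 -> {poly F}) (be : Y1 -> Y2 -> {poly F})
    (ga : Z1 -> Z2 -> {poly F}) (h : nat),
    forall x2 y2 z2,
      let P := \sum_(x1 : X1) \sum_(y1 : Y1) \sum_(z1 : Z1)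
                 T1 x1 y1 z1 *: (al x1 x2 * be y1 y2 * ga z1 z2) in
      P`_h = T2 x2 y2 z2 /\ forall e, (e < h)%N -> P`_e = 0.

Definition tensor_rot (X Y Z : finType) (T : tensor X Y Z) : tensor Y Z X :=
  fun y z x => T x y z.

Definition tensor_iso (X1 Y1 Z1 X2 Y2 Z2 : finType)
    (T1 : tensor X1 Y1 Z1) (T2 : tensor X2 Y2 Z2) : Prop :=
  exists (f : X1 -> X2) (g : Y1 -> Y2) (h : Z1 -> Z2),
    [/\ bijective f, bijective g, bijective h
      & forall x y z, T1 x y z = T2 (f x) (g y) (h z)].

Definition variable_symmetric (X Y Z : finType) (T : tensor X Y Z) : Prop :=
  tensor_iso T (tensor_rot T).

Section Partitioned.
Variables (X Y Z : finType) (T : tensor X Y Z) (k : nat).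
Variables (PX : 'I_k -> {set X}) (PY : 'I_k -> {set Y}) (PZ : 'I_k -> {set Z}).

Definition tensor_block (i j l : 'I_k) : tensor X Y Z :=
  fun x y z => if [&& x \in PX i, y \in PY j & z \in PZ l] then T x y z else 0.

Definition nonzero_blocks : {set 'I_k * 'I_k * 'I_k} :=
  [set t | ~~ tensor_zero (tensor_block t.1.1 t.1.2 t.2)].

Definition symmetric_partitions : Prop :=
  (forall i, #|PX i| = #|PY i| /\ #|PY i| = #|PZ i|) /\
  (forall i j l, tensor_iso (tensor_block j l i) (tensor_rot (tensor_block i j l))).

(* Parts are numbered from 1 in condition (2), whereas ['I_k] starts at 0. *)
Definition laser_ready : Prop :=
  [/\ forall i j l, tensor_zero (tensor_block i j l) \/
        exists a b c : nat,
          [/\ degenerates (tensor_block i j l) (matmul_tensor a b c),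
              (a * b)%N = #|PX i|, (b * c)%N = #|PY j| & (c * a)%N = #|PZ l|],
      exists ell : int, forall i j l : 'I_k, ~~ tensor_zero (tensor_block i j l) ->
        (i.+1 + j.+1 + l.+1)%N%:Z = ell
    & variable_symmetric T /\ symmetric_partitions].

End Partitioned.
End Tensors.
Arguments tensor_pow {F X Y Z} T n _ _ _.
Arguments matmul_tensor F a b c _ _ _ : clear implicits.

(* Pairwise disjoint sets covering [A]; parts may be empty. *)
Definition part_family (A : finType) (k : nat) (P : 'I_k -> {set A}) : Prop :=
  (forall x : A, exists i, x \in P i) /\
  (forall i j, i != j -> [disjoint P i & P j]).

Section Laser.
Variables (R : realType) (F : fieldType).

Definition asymptotic_rank (X Y Z : finType) (T : tensor F X Y Z) : R :=
  limn_inf (fun n => (tensor_rank (tensor_pow T n))%:R `^ (n%:R^-1)).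

(* [n], [m] and the dimensions are positive: [n = 0] would make every [w]
   admissible, and zero dimensions would meet the convention [0 `^ 0 = 1].
   The infimum is taken in [\bar R], so it is [+oo] if no [w] is admissible. *)
Definition universal_exponent (X Y Z : finType) (T : tensor F X Y Z) (w : R) : Prop :=
  exists (n m : nat) (a b c : 'I_m -> nat),
    [/\ (0 < n)%N, (0 < m)%N,
        forall i, [/\ (0 < a i)%N, (0 < b i)%N & (0 < c i)%N],
        degenerates (tensor_pow T n)
          (tensor_dsum (fun i => matmul_tensor F (a i) (b i) (c i)))
      & \sum_(i < m) (a i * b i * c i)%:R `^ (w / 3) = asymptotic_rank T ^+ n].

Definition omega_u (X Y Z : finType) (T : tensor F X Y Z) : \bar R :=
  ereal_inf [set w%:E | w in [set w : R | universal_exponent T w]]%classic.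

(* A distribution on [L] is extended by 0 to all triples of indices. *)
Definition sym_distr (k : nat) (L : {set 'I_k * 'I_k * 'I_k})
    (p : 'I_k * 'I_k * 'I_k -> R) : Prop :=
  [/\ forall t, 0 <= p t,
      forall t, t \notin L -> p t = 0,
      \sum_(t in L) p t = 1
    & forall i j l, p (i, j, l) = p (j, l, i)].

Definition marginal (k : nat) (L : {set 'I_k * 'I_k * 'I_k})
    (p : 'I_k * 'I_k * 'I_k -> R) (i : 'I_k) : R :=
  \sum_(t in L | t.1.1 == i) p t.

Definition laser_A (X : finType) (k : nat) (L : {set 'I_k * 'I_k * 'I_k})
    (PX : 'I_k -> {set X}) (p : 'I_k * 'I_k * 'I_k -> R) : R :=
  \prod_(t in L) #|PX t.1.1|%:R `^ p t.

Definition laser_C (k : nat) (L : {set 'I_k * 'I_k * 'I_k})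
    (p : 'I_k * 'I_k * 'I_k -> R) : R :=
  \prod_(i < k) marginal L p i `^ (- marginal L p i).

End Laser.

(* Main.v *)
From HB Require Import structures.
Require Import Defs.
From mathcomp Require Import all_boot all_order all_algebra.
From mathcomp Require Import boolp classical_sets reals ereal topology sequences exp.
From mathcomp Require Import finmap normedtype.
From mathcomp Require Import ring lra zify.
Import Order.TTheory GRing.Theory Num.Theory.
Import numFieldNormedType.Exports.
Local Open Scope ring_scope.
Set Implicit Arguments.
Unset Strict Implicit.
Unset Printing Implicit Defensive.

(* A cover of the support of a tensor by x-, y- and z-slices survives degeneration,
   with no more slices, when the support of the target is an antichain for some
   orders on its variables (the Sawin-Tao slice rank bound).  Powers of direct sums
   of matrix multiplication tensors have such a support, and counting the terms
   whose tag sequence has a given type shows that a cover with |G_X|, |G_Y|, |G_Z|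
   slices forces #(sequences) * ABC <= |G_X| C + |G_Y| A + |G_Z| B.

   Upstairs, a probability weight q on the parts, spread uniformly inside each
   part, gives every variable of T^N a weight, and at most 1/theta variables have
   weight >= theta.  For a term of T^N whose symmetrised empirical distribution is
   p, the weights of its x, y and z multiply to exp(-3N sum_i p(X_i) ln(|X_i|/q_i)),
   and for q close to p the sum is close to ln(C_p A_p) < ln R~(T).  As P^sym is
   compact, finitely many q serve all p, with a uniform bound s < R~(T).  Balancing
   the thresholds theta against A, B, C and letting N grow gives
   sum_i (a_i b_i c_i)^(2/3) <= s^n for every degeneration of T^n, whence
   w >= 2 ln R~(T) / ln s > 2. *)

(** * Slice covers of the support under degeneration *)

(** While all values vanish at 0, one more factor ['X] can be divided out of the whole family. The
    size of the nonzero [e j] drops each time, so the process stops at the least ['X]-valuation,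
    where some quotient has a nonzero constant term. *)
Lemma common_X_factor (F : fieldType) (I : finType) (P : pred I)
    (e : I -> {poly F}) (j : I) : P j -> e j != 0 ->
  exists (m : nat) (e' : I -> {poly F}),
    (forall i, P i -> e i = 'X^m * e' i) /\ exists2 i, P i & (e' i).[0] != 0.
Proof.
move=> Pj; have [n] := ubnP (size (e j)); elim: n e => // n IHn e lt_n nz_ej.
have [/existsP[i /andP[Pi ei]]|/existsPn root_e] := boolP [exists i, P i && ((e i).[0] != 0)].
  by exists 0, e; split=> [i' _|]; [rewrite expr0 mul1r | exists i].
have divX i : P i -> e i = 'X * (e i %/ 'X).
  move=> Pi; rewrite mulrC divpK //.
  have := root_e i; rewrite Pi negbK /= => ei0.
  have -> : 'X = 'X - 0%:P :> {poly F} by rewrite polyC0 subr0.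
  by rewrite dvdp_XsubCl.
have nz' : e j %/ 'X != 0.
  by apply: contra_neq nz_ej => ej0; rewrite (divX j Pj) ej0 mulr0.
have /= [||m [e' [def_e ex]]] := IHn (fun i => e i %/ 'X) => //.
  move: lt_n; rewrite {1}(divX j Pj) mulrC size_mulX //.
by exists m.+1, e'; split=> // i Pi; rewrite divX // def_e // exprS mulrA.
Qed.

(** Gaussian elimination that stays valid at ['X = 0]. Each equation uses up one pivot index, which
    joins [J]. For every other [j] there remains an exact solution over the polynomials whose value
    at 0 has [j] as its least index. *)
Lemma kernel_echelon (F : fieldType) (A : eqType) (I : finType) (d : Order.disp_t)
    (O : orderType d) (rk : I -> O) (K : A -> I -> {poly F}) (s : seq A) :
  injective rk ->
  exists2 J : {set I}, (#|J| <= size s)%N & forall j, j \notin J ->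
    exists v : I -> {poly F},
      [/\ forall a, a \in s -> \sum_i K a i * v i = 0, (v j).[0] != 0
        & forall i, (rk i < rk j)%O -> (v i).[0] = 0].
Proof.
move=> rk_inj; elim: s => [|a s [J leJ /= ker]].
  exists finset.set0; rewrite ?cards0 // => j _.
  exists (fun i => (i == j)%:R%:P); split=> // [|i].
    by rewrite hornerC eqxx oner_neq0.
  by case: eqP => [->|_]; rewrite ?ltxx // hornerC.
have /choice[V kerV] j : exists v : I -> {poly F}, j \notin J ->
    [/\ forall a, a \in s -> \sum_i K a i * v i = 0, (v j).[0] != 0
      & forall i, (rk i < rk j)%O -> (v i).[0] = 0].
  by case: (boolP (j \in J)) => [|/ker[v]]; [exists (fun=> 0) | exists v].
pose e j : {poly F} := \sum_i K a i * V j i.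
have [/existsP[j1 /andP[Jj1 nz_e]]|/existsPn e0] :=
  boolP [exists j, (j \notin J) && (e j != 0)]; last first.
  exists J; first exact: leqW.
  move=> j Jj; have [kerVj Vj Vlt] := kerV j Jj; exists (V j); split=> // b.
  rewrite inE => /predU1P[->|/kerVj //].
  by have := e0 j; rewrite Jj negbK => /eqP.
have [m [e' [def_e [j2 Jj2 nz_j2]]]] := @common_X_factor F I [pred j | j \notin J] e j1 Jj1 nz_e.
have := @Order.TotalTheory.arg_maxP d O I j2 [pred j | (j \notin J) && ((e' j).[0] != 0)] rk.
(* Eliminating with the values e' j of least 'X-valuation, and among these the largest
   index, keeps both the unit at j and the zeros below j. *)
case=> [|j0 /andP[Jj0 nz0] max0]; first by rewrite /= nz_j2 andbT; exact: Jj2.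
exists (j0 |: J); first by rewrite cardsU1 Jj0 ltnS.
move=> j; rewrite in_setU1 negb_or => /andP[j_j0 Jj].
have [kerj nzj ltj] := kerV j Jj; have [ker0 nzj0 lt0] := kerV j0 Jj0.
exists (fun i => e' j0 * V j i - e' j * V j0 i).
have sumE b : \sum_i K b i * (e' j0 * V j i - e' j * V j0 i)
    = e' j0 * (\sum_i K b i * V j i) - e' j * (\sum_i K b i * V j0 i).
  rewrite !mulr_sumr -sumrB; apply: eq_bigr => i _.
  by rewrite mulrBr !(mulrCA (K b i)).
have vanish i : (rk i < rk j)%O -> (e' j * V j0 i).[0] = 0.
  rewrite hornerM => lt_ij; have [lt_j|ge_j] := ltP (rk j) (rk j0).
    by rewrite (lt0 i) ?mulr0 // (lt_trans lt_ij).
  suff -> : (e' j).[0] = 0 by rewrite mul0r.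
  apply/eqP; apply: contraNT j_j0 => nz; apply/eqP/rk_inj/le_anti.
  by rewrite ge_j andbT; apply: max0; rewrite /= Jj.
split=> [b|| i lt_ij].
- rewrite inE sumE => /predU1P[->|bs]; last by rewrite kerj // ker0 // !mulr0 subrr.
  rewrite -/(e j) -/(e j0) !def_e // !mulrA (mulrC (e' j0)) (mulrC (e' j)).
  by rewrite -!mulrA (mulrC (e' j)) subrr.
- rewrite hornerD hornerN !hornerM.
  have [lt_j|ge_j] := ltP (rk j) (rk j0); first by rewrite (lt0 j) // mulr0 subr0 mulf_neq0.
  suff -> : (e' j).[0] = 0 by rewrite mul0r subr0 mulf_neq0.
  apply/eqP; apply: contraNT j_j0 => nz; apply/eqP/rk_inj/le_anti.
  by rewrite ge_j andbT; apply: max0; rewrite /= Jj.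
- by rewrite hornerD hornerN vanish // hornerM ltj // mulr0 subr0.
Qed.

(** With the power of ['X] split off as a factor, an identity between polynomials can be divided by
    ['X^h] first and evaluated at 0 afterwards. *)
Lemma degeneratesP (F : fieldType) (X1 Y1 Z1 X2 Y2 Z2 : finType)
    (T1 : tensor F X1 Y1 Z1) (T2 : tensor F X2 Y2 Z2) :
  degenerates T1 T2 <->
  exists (al : X1 -> X2 -> {poly F}) (be : Y1 -> Y2 -> {poly F})
    (ga : Z1 -> Z2 -> {poly F}) (h : nat) (Q : X2 -> Y2 -> Z2 -> {poly F}),
    forall x2 y2 z2,
      \sum_x1 \sum_y1 \sum_z1 T1 x1 y1 z1 *: (al x1 x2 * be y1 y2 * ga z1 z2)
        = 'X^h * Q x2 y2 z2 /\ (Q x2 y2 z2).[0] = T2 x2 y2 z2.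
Proof.
split=> [[al [be [ga [h deg]]]]|[al [be [ga [h [Q deg]]]]]].
  exists al, be, ga, h.
  exists (fun x2 y2 z2 => drop_poly h (\sum_x1 \sum_y1 \sum_z1
    T1 x1 y1 z1 *: (al x1 x2 * be y1 y2 * ga z1 z2))).
  move=> x2 y2 z2; have /= [Ph Plt] := deg x2 y2 z2.
  set P := \sum_x1 _ in Ph Plt *; split.
    rewrite mulrC -[LHS](poly_take_drop h).
    suff -> : take_poly h P = 0 by rewrite add0r.
    by apply/polyP => i; rewrite coef_take_poly coef0; case: ifP => // /Plt.
  by rewrite horner_coef0 coef_drop_poly.
exists al, be, ga, h => x2 y2 z2 /=; have [-> <-] := deg x2 y2 z2.
rewrite horner_coef0 !coefXnM ltnn subnn; split=> // e lt_eh.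
by rewrite coefXnM lt_eh.
Qed.

Lemma exchange_big3 (V : nmodType) (I J K L : finType) (f : I -> J -> K -> L -> V) :
  \sum_i \sum_j \sum_k \sum_l f i j k l = \sum_l \sum_i \sum_j \sum_k f i j k l.
Proof.
rewrite [RHS]exchange_big; apply: eq_bigr => i _.
rewrite [RHS]exchange_big; apply: eq_bigr => j _.
exact: exchange_big.
Qed.

Definition antichain_support (F : fieldType) (X Y Z : finType) (T : tensor F X Y Z)
    (d : Order.disp_t) (O : orderType d) (f : X -> O) (g : Y -> O) (h : Z -> O) : Prop :=
  [/\ injective f, injective g, injective h
    & forall x y z x' y' z', T x y z != 0 -> T x' y' z' != 0 ->
     (f x <= f x')%O -> (g y <= g y')%O -> (h z <= h z')%O ->
     [/\ x = x', y = y' & z = z']].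

(** Suppose a term (x, y, z) of [T2] escapes the three pivot sets. Contract with the kernel vectors
    u, v, w attached to x, y, z. Each term of [T1] lies in a covered slice, so one of its three
    factors is 0 and the contraction of [Q] vanishes. At 0 the vectors live at or above x, y, z, so
    by the antichain property only the nonzero term at (x, y, z) itself survives, a
    contradiction. *)
Lemma degeneration_support_cover (F : fieldType) (X1 Y1 Z1 X2 Y2 Z2 : finType)
    (T1 : tensor F X1 Y1 Z1) (T2 : tensor F X2 Y2 Z2)
    (d : Order.disp_t) (O : orderType d) (f : X2 -> O) (g : Y2 -> O) (h : Z2 -> O)
    (GX : {set X1}) (GY : {set Y1}) (GZ : {set Z1}) :
  antichain_support T2 f g h -> degenerates T1 T2 ->
  (forall x y z, T1 x y z != 0 -> [|| x \in GX, y \in GY | z \in GZ]) ->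
  exists (JX : {set X2}) (JY : {set Y2}) (JZ : {set Z2}),
    [/\ (#|JX| <= #|GX|)%N, (#|JY| <= #|GY|)%N, (#|JZ| <= #|GZ|)%N
      & forall x y z, T2 x y z != 0 -> [|| x \in JX, y \in JY | z \in JZ]].
Proof.
case=> f_inj g_inj h_inj anti /degeneratesP[al [be [ga [e [Q deg]]]]] cov.
have [JX leX kerX] := kernel_echelon al (enum GX) f_inj.
have [JY leY kerY] := kernel_echelon be (enum GY) g_inj.
have [JZ leZ kerZ] := kernel_echelon ga (enum GZ) h_inj.
exists JX, JY, JZ; split; rewrite 1?[leqRHS]cardE //.
move=> x y z nz.
apply/negPn; rewrite !negb_or; apply/negP => /and3P[/kerX[u [ku ux ult]]].
move=> /kerY[v [kv vy vlt]] /kerZ[w [kw wz wlt]].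
have Q0 : \sum_x' \sum_y' \sum_z' u x' * v y' * w z' * Q x' y' z' = 0.
  apply: (@mulfI _ ('X^e)); first by rewrite expf_neq0 // polyX_eq0.
  rewrite mulr0 mulr_sumr.
  transitivity (\sum_x1 \sum_y1 \sum_z1 T1 x1 y1 z1 *:
      ((\sum_x' al x1 x' * u x') * (\sum_y' be y1 y' * v y')
        * (\sum_z' ga z1 z' * w z'))); last first.
    rewrite big1 // => x1 _; rewrite big1 // => y1 _; rewrite big1 // => z1 _.
    have [->|/cov/or3P[]in1] := eqVneq (T1 x1 y1 z1) 0; first by rewrite scale0r.
    - by rewrite ku ?mem_enum // !mul0r scaler0.
    - by rewrite kv ?mem_enum // mulr0 mul0r scaler0.
    - by rewrite kw ?mem_enum // mulr0 scaler0.
  transitivity (\sum_x' \sum_y' \sum_z' \sum_x1 \sum_y1 \sum_z1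
     T1 x1 y1 z1 *: (al x1 x' * u x' * (be y1 y' * v y') * (ga z1 z' * w z'))).
    apply: eq_bigr => x' _; rewrite mulr_sumr; apply: eq_bigr => y' _.
    rewrite mulr_sumr; apply: eq_bigr => z' _; have [def_Q _] := deg x' y' z'.
    rewrite mulrCA -def_Q mulr_sumr; apply: eq_bigr => x1 _.
    rewrite mulr_sumr; apply: eq_bigr => y1 _; rewrite mulr_sumr.
    apply: eq_bigr => z1 _; rewrite -scalerAr; congr (_ *: _).
    by ring.
  rewrite exchange_big3; apply: eq_bigr => x1 _.
  rewrite exchange_big3; apply: eq_bigr => y1 _.
  rewrite exchange_big3; apply: eq_bigr => z1 _.
  rewrite 2!mulr_suml scaler_sumr; apply: eq_bigr => x' _ /=.
  rewrite mulrAC mulr_sumr scaler_sumr; apply: eq_bigr => y' _ /=.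
  by rewrite mulrAC mulr_sumr scaler_sumr.
have vanish x' y' z' : T2 x' y' z' != 0 -> (x', y', z') <> (x, y, z) ->
    (u x' * v y' * w z').[0] = 0.
  move=> nz' neq; rewrite !hornerM.
  have [/ult->|gex] := ltP (f x') (f x); first by rewrite !mul0r.
  have [/vlt->|gey] := ltP (g y') (g y); first by rewrite mulr0 mul0r.
  have [/wlt->|gez] := ltP (h z') (h z); first by rewrite mulr0.
  by case: neq; have [-> -> ->] := anti _ _ _ _ _ _ nz nz' gex gey gez.
have : (u x * v y * w z * Q x y z).[0] != 0.
  by have [_ TQ] := deg x y z; rewrite !hornerM TQ !mulf_neq0.
have term0 x' y' z' : (x', y', z') <> (x, y, z) -> (u x' * v y' * w z' * Q x' y' z').[0] = 0.
  move=> neq; have [_ TQ] := deg x' y' z'; rewrite hornerM TQ.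
  by have [->|/vanish->//] := eqVneq (T2 x' y' z') 0; rewrite ?mulr0 ?mul0r.
case/eqP; have /(congr1 (horner^~ 0)) := Q0; rewrite horner0 => sum0; rewrite -[RHS]sum0.
rewrite (bigD1 x) //= (bigD1 y) //= (bigD1 z) //= !hornerD !horner_sum.
rewrite !big1 ?addr0 // => i ne_i.
- rewrite horner_sum big1 // => j _; rewrite horner_sum big1 // => l _.
  by rewrite term0 // => -[eq_x]; rewrite eq_x eqxx in ne_i.
- rewrite horner_sum big1 // => l _.
  by rewrite term0 // => -[eq_y]; rewrite eq_y eqxx in ne_i.
- by rewrite term0 // => -[eq_z]; rewrite eq_z eqxx in ne_i.
Qed.

(** * Degenerations and antichains in tensor powers *)

Lemma degenerates_pow (F : fieldType) (X1 Y1 Z1 X2 Y2 Z2 : finType)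
    (T1 : tensor F X1 Y1 Z1) (T2 : tensor F X2 Y2 Z2) (n : nat) :
  degenerates T1 T2 -> degenerates (tensor_pow T1 n) (tensor_pow T2 n).
Proof.
move=> /degeneratesP[al [be [ga [h [Q deg]]]]]; apply/degeneratesP.
exists (fun (x1 : {ffun 'I_n -> X1}) (x2 : {ffun 'I_n -> X2}) => \prod_i al (x1 i) (x2 i)),
  (fun (y1 : {ffun 'I_n -> Y1}) (y2 : {ffun 'I_n -> Y2}) => \prod_i be (y1 i) (y2 i)),
  (fun (z1 : {ffun 'I_n -> Z1}) (z2 : {ffun 'I_n -> Z2}) => \prod_i ga (z1 i) (z2 i)), (h * n)%N,
  (fun (x2 : {ffun 'I_n -> X2}) (y2 : {ffun 'I_n -> Y2}) (z2 : {ffun 'I_n -> Z2}) =>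
     \prod_i Q (x2 i) (y2 i) (z2 i)) => x2 y2 z2; split; last first.
  by rewrite horner_prod; apply: eq_bigr => i _; have [] := deg (x2 i) (y2 i) (z2 i).
have -> : 'X^(h * n) = \prod_(i < n) 'X^h :> {poly F}.
  by rewrite prodr_const card_ord exprM.
rewrite -big_split /=.
under [RHS]eq_bigr => i _ do have [<- _] := deg (x2 i) (y2 i) (z2 i).
rewrite bigA_distr_bigA; apply: eq_bigr => x1 _.
rewrite bigA_distr_bigA; apply: eq_bigr => y1 _.
rewrite bigA_distr_bigA; apply: eq_bigr => z1 _.
by rewrite scaler_prod -!big_split.
Qed.

Definition lex_pow (d : Order.disp_t) (O : orderType d) (A : Type) (f : A -> O) (n : nat)
  (x : {ffun 'I_n -> A}) : n.-tuplelexi O := [tuple f (x i) | i < n].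

Lemma lex_pow_inj (d : Order.disp_t) (O : orderType d) (A : Type) (f : A -> O) (n : nat) :
  injective f -> injective (@lex_pow d O A f n).
Proof.
move=> f_inj x x' /(congr1 (fun t => tnth t)) eq_t; apply/ffunP => i.
by have /(congr1 (fun g => g i)) := eq_t; rewrite !tnth_mktuple => /f_inj.
Qed.

Lemma lex_pow_le (d : Order.disp_t) (O : orderType d) (A : Type) (f : A -> O) (n : nat)
    (x x' : {ffun 'I_n -> A}) (k : 'I_n) :
  (lex_pow f x <= lex_pow f x')%O -> (forall i : 'I_n, (i < k)%N -> x i = x' i) ->
  (f (x k) <= f (x' k))%O.
Proof.
move=> le_x eq_x; rewrite leNgt; apply: contraL le_x => lt_k; rewrite -ltNge.
apply/ltxi_tuplePlt; exists k => [i /eq_x eq_i|]; by rewrite !tnth_mktuple ?eq_i.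
Qed.

(** Once two terms agree in their first k positions, the three lexicographic comparisons descend to
    position k, where the antichain property of [T] forces agreement again. *)
Lemma antichain_pow (F : fieldType) (X Y Z : finType) (T : tensor F X Y Z)
    (d : Order.disp_t) (O : orderType d) (f : X -> O) (g : Y -> O) (h : Z -> O) (n : nat) :
  antichain_support T f g h ->
  antichain_support (tensor_pow T n) (lex_pow f (n := n)) (lex_pow g (n := n))
    (lex_pow h (n := n)).
Proof.
case=> f_inj g_inj h_inj anti; split; try exact: lex_pow_inj.
move=> x y z x' y' z'; rewrite /tensor_pow !prodf_seq_neq0.
move=> /allP nz /allP nz' le_x le_y le_z.
have nzE i : T (x i) (y i) (z i) != 0 by apply: nz; rewrite mem_index_enum.
have nzE' i : T (x' i) (y' i) (z' i) != 0 by apply: nz'; rewrite mem_index_enum.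
suff eq_all k : forall i : 'I_n, (i < k)%N -> [/\ x i = x' i, y i = y' i & z i = z' i].
  by split; apply/ffunP => i; case: (eq_all n i (ltn_ord i)).
elim: k => // k IHk i; rewrite ltnS leq_eqVlt => /predU1P[eq_ik|]; last exact: IHk.
by apply: anti => //; apply: lex_pow_le => // j; rewrite eq_ik => /IHk[].
Qed.

(** * The support of a direct sum of matrix multiplication tensors *)

(** Numerals in base [K] turn lexicographic comparison of index tuples into comparison of natural
    numbers. *)
Lemma digits_le (K u u' v v' : nat) : (u * K + v <= u' * K + v')%N ->
  (v < K)%N -> (v' < K)%N -> u = u' /\ (v <= v')%N \/ (u < u')%N.
Proof.
move=> le_uv ltv ltv'; have [lt_u|lt_u|eq_u] := ltngtP u u'; [by right| |by left; subst; lia].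
by exfalso; have : (u'.+1 * K <= u * K)%N; [rewrite leq_mul2r lt_u orbT | rewrite mulSn; lia].
Qed.

Lemma digits_eq (K u u' v v' : nat) : (u * K + v = u' * K + v')%N ->
  (v < K)%N -> (v' < K)%N -> u = u' /\ v = v'.
Proof.
move=> eq_uv ltv ltv'.
have [|le1] := digits_le (eq_leq eq_uv) ltv ltv';
  have [|le2] := digits_le (eq_leq (esym eq_uv)) ltv' ltv; lia.
Qed.

Lemma untag_existT (I : eqType) (T_ : I -> Type) (U : Type) (idx : U) (i : I)
    (f : T_ i -> U) (t : T_ i) :
  untag idx f (existT T_ i t) = f t.
Proof. exact: (@untagE I T_ U idx i f (existT T_ i t) erefl). Qed.

Section MatmulSum.
Variables (F : fieldType) (m : nat) (a b c : 'I_m -> nat).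

Definition mmX := {i : 'I_m & 'I_(a i) * 'I_(b i)}%type.
Definition mmY := {i : 'I_m & 'I_(b i) * 'I_(c i)}%type.
Definition mmZ := {i : 'I_m & 'I_(c i) * 'I_(a i)}%type.
(** Indexes the monomials of the direct sum, all of coefficient 1: (al, be, ga) in summand i stands
    for the product of the variables (al, be), (be, ga) and (ga, al). *)
Definition mm_term := {i : 'I_m & 'I_(a i) * 'I_(b i) * 'I_(c i)}%type.

Definition termX (e : mm_term) : mmX :=
  existT _ (tag e) ((tagged e).1.1, (tagged e).1.2).
Definition termY (e : mm_term) : mmY :=
  existT _ (tag e) ((tagged e).1.2, (tagged e).2).
Definition termZ (e : mm_term) : mmZ :=
  existT _ (tag e) ((tagged e).2, (tagged e).1.1).

Definition mm_sum : tensor F mmX mmY mmZ :=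
  tensor_dsum (fun i => matmul_tensor F (a i) (b i) (c i)).

Lemma mm_sum_neq0 (x : mmX) (y : mmY) (z : mmZ) :
  mm_sum x y z != 0 <-> exists e, [/\ x = termX e, y = termY e & z = termZ e].
Proof.
rewrite /mm_sum /tensor_dsum; split.
  have [eq_y|ne_y] := eqVneq (tag y) (tag x); last by rewrite untag_dflt // eqxx.
  have [eq_z|ne_z] := eqVneq (tag z) (tag x); last first.
    by rewrite (untagE _ _ eq_y) untag_dflt // eqxx.
  case: x y z eq_y eq_z => [i [al be]] [j [be' ga]] [l [ga' al']] /= eq_j eq_l.
  subst j l; rewrite !untag_existT /= /matmul_tensor /=.
  have [/andP[/andP[/eqP <- /eqP <-] /eqP ->] _|_] := boolP (_ && _ && _).
    by exists (existT _ i (al, be, ga)).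
  by rewrite eqxx.
case=> -[i [[al be] ga]] [-> -> ->] /=.
by rewrite !untag_existT /= /matmul_tensor /= !eqxx oner_neq0.
Qed.

Lemma mm_sum_antichain : exists (f : mmX -> nat) (g : mmY -> nat) (h : mmZ -> nat),
  antichain_support mm_sum f g h.
Proof.
have [K ltK] : exists K, forall i : 'I_m, [/\ (i < K)%N, (a i < K)%N, (b i < K)%N & (c i < K)%N].
  exists (m + \sum_i (a i + b i + c i)).+1 => i.
  have := ltn_ord i; rewrite (bigD1 i) //=; move: (\sum_(j | _) _)%N => S.
  by move=> lt_im; split; lia.
(* x = (i, al, be) is ordered by i, al, be; z = (i, ga, al) by decreasing (i, al), then ga,
   so that x and z together fix (i, al); y = (i, be, ga) by i, then decreasing be and ga. *)
pose f (x : mmX) := ((tag x * K + (tagged x).1) * K + (tagged x).2)%N.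
pose g (y : mmY) := ((tag y * K + (K.-1 - (tagged y).1)) * K + (K.-1 - (tagged y).2))%N.
pose h (z : mmZ) := ((K * K - (tag z * K + (tagged z).2)) * K + (tagged z).1)%N.
(* This bound keeps the truncated subtraction from [K * K] in [h] exact. *)
have ltKK i j : (j < K)%N -> (i < m)%N -> (i * K + j < K * K)%N.
  move=> ltj lti; have : (i < K)%N by have := ltK (Ordinal lti); case.
  by move=> ltiK; have : (i.+1 * K <= K * K)%N; [rewrite leq_mul2r ltiK orbT | rewrite mulSn; lia].
exists f, g, h; split.
- case=> [i [x1 x2]] [i' [x1' x2']]; rewrite /f /= => eq_n.
  have [_ a_i b_i _] := ltK i; have [_ a_i' b_i' _] := ltK i'.
  have := ltn_ord x1; have := ltn_ord x2; have := ltn_ord x1'; have := ltn_ord x2' => ? ? ? ?.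
  have [eq_q e2] := digits_eq eq_n ltac:(lia) ltac:(lia).
  have [eq_i e1] := digits_eq eq_q ltac:(lia) ltac:(lia).
  have {}eq_i := ord_inj eq_i; subst i'.
  by rewrite (ord_inj e1) (ord_inj e2).
- case=> [i [x1 x2]] [i' [x1' x2']]; rewrite /g /= => eq_n.
  have [_ _ b_i c_i] := ltK i; have [_ _ b_i' c_i'] := ltK i'.
  have := ltn_ord x1; have := ltn_ord x2; have := ltn_ord x1'; have := ltn_ord x2' => ? ? ? ?.
  have [eq_q e2] := digits_eq eq_n ltac:(lia) ltac:(lia).
  have [eq_i e1] := digits_eq eq_q ltac:(lia) ltac:(lia).
  have {}eq_i := ord_inj eq_i; subst i'.
  have -> : x1 = x1' by apply: ord_inj; lia.
  by have -> : x2 = x2' by apply: ord_inj; lia.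
- case=> [i [x1 x2]] [i' [x1' x2']]; rewrite /h /= => eq_n.
  have [_ a_i _ c_i] := ltK i; have [_ a_i' _ c_i'] := ltK i'.
  have := ltn_ord x1; have := ltn_ord x2; have := ltn_ord x1'; have := ltn_ord x2' => ? ? ? ?.
  have [e e1] := digits_eq eq_n ltac:(lia) ltac:(lia).
  have lt1 := @ltKK i x2 ltac:(lia) (ltn_ord i).
  have lt2 := @ltKK i' x2' ltac:(lia) (ltn_ord i').
  have [eq_i e2] := @digits_eq K i i' x2 x2' ltac:(lia) ltac:(lia) ltac:(lia).
  have {}eq_i := ord_inj eq_i; subst i'.
  by rewrite (ord_inj e1) (ord_inj e2).
move=> x y z x' y' z' /mm_sum_neq0[[i [[al be] ga]] [-> -> ->]].
move=> /mm_sum_neq0[[i' [[al' be'] ga']] [-> -> ->]].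
rewrite /f /g /h /termX /termY /termZ !leEnat /= => le_x le_y le_z.
have [_ a_i b_i c_i] := ltK i; have [_ a_i' b_i' c_i'] := ltK i'.
have := ltn_ord al; have := ltn_ord be; have := ltn_ord ga => ? ? ?.
have := ltn_ord al'; have := ltn_ord be'; have := ltn_ord ga' => ? ? ?.
have lt1 := @ltKK i al ltac:(lia) (ltn_ord i).
have lt2 := @ltKK i' al' ltac:(lia) (ltn_ord i').
(* A strict increase of (i, al) in x would be a strict decrease in z. So (i, al) agrees, x and z
   give be <= be' and ga <= ga', and the reversed digits of y turn both into equalities. *)
have [[eq_x le_be]|lt_x] := digits_le le_x ltac:(lia) ltac:(lia); last first.
  by have := digits_le le_z ltac:(lia) ltac:(lia); lia.
have [eq_i eq_al] := digits_eq eq_x ltac:(lia) ltac:(lia).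
have {}eq_i := ord_inj eq_i; subst i'.
have {}eq_al := ord_inj eq_al; subst al'.
have le_ga : (ga <= ga')%N by have := digits_le le_z ltac:(lia) ltac:(lia); lia.
have := digits_le le_y ltac:(lia) ltac:(lia) => cmp_y.
have -> : be' = be by apply: ord_inj; lia.
by have -> : ga' = ga by apply: ord_inj; lia.
Qed.
End MatmulSum.

(** * Counting terms with prescribed tag sequences *)

Lemma card_family_prod (I J : finType) (Q : I -> pred J) :
  #|family Q| = (\prod_i #|Q i|)%N.
Proof.
rewrite -sum1_card; under [RHS]eq_bigr do rewrite -sum1_card.
rewrite (bigA_distr_big_dep Q (fun _ _ => 1%N)); apply: eq_bigr => f _.
by rewrite big1.
Qed.

(** A slice fixes the tag sequence s of its terms, and the fibres over the n positions multiply to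
    at most the product of the [c (s t)], which is [C] on [S]. *)
Lemma card_preim_pow_le (m n C : nat) (J X : finType) (tagJ : J -> 'I_m)
    (tagX : X -> 'I_m) (c : 'I_m -> nat) (pr : J -> X) (S : {set {ffun 'I_n -> 'I_m}})
    (JX : {set {ffun 'I_n -> X}}) :
  (forall e, tagX (pr e) = tagJ e) ->
  (forall x, (#|[pred e | pr e == x]| <= c (tagX x))%N) ->
  (forall s, s \in S -> \prod_t c (s t) = C)%N ->
  (#|[set e : {ffun 'I_n -> J} | ([ffun t => tagJ (e t)] \in S)
        && ([ffun t => pr (e t)] \in JX)]| <= #|JX| * C)%N.
Proof.
move=> tag_pr fib prodC; rewrite -sum1_card.
rewrite (partition_big (fun e : {ffun 'I_n -> J} => [ffun t => pr (e t)]) (mem JX)) /=; last first.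
  by move=> e; rewrite inE => /andP[].
rewrite -sum_nat_const; apply: leq_sum => x _.
(* A slice whose tag sequence lies outside [S] contributes nothing; otherwise a witness [e0] shows
   that its sequence is in [S]. *)
have [/existsP[e0]|/existsPn noe] := boolP [exists e : {ffun 'I_n -> J},
    ([ffun t => tagJ (e t)] \in S) && ([ffun t => pr (e t)] == x)]; last first.
  rewrite big_pred0 // => e; rewrite inE; apply/negbTE; move: (noe e).
  by apply: contraNN => /andP[/andP[-> _] ->].
move=> /andP[/prodC <- /eqP def_x]; rewrite sum1_card.
apply: (@leq_trans #|family (fun t => [pred e | pr e == x t])|).
  apply/subset_leq_card/fintype.subsetP => e; rewrite !inE => /andP[_ /eqP <-].
  by apply/familyP => t; rewrite inE ffunE.
rewrite card_family_prod; apply: leq_prod => t _; rewrite ffunE -tag_pr.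
by have := fib (x t); rewrite -def_x ffunE.
Qed.

Section Count.
Variables (m n : nat) (a b c : 'I_m -> nat).

Lemma card_term_tag (i : 'I_m) : #|[pred e : mm_term a b c | tag e == i]| = (a i * b i * c i)%N.
Proof.
rewrite -sum1_card; transitivity (\sum_(e : mm_term a b c | (tag e == i) && true) 1)%N.
  by apply: eq_bigl => e; rewrite andbT.
rewrite -(sig_big_dep (fun j : 'I_m => j == i) (fun _ _ => true) (fun _ _ => 1%N)) /=.
by rewrite big_pred1_eq sum1_card !card_prod !card_ord.
Qed.

Lemma card_termX (x : mmX a b) : (#|[pred e : mm_term a b c | termX e == x]| <= c (tag x))%N.
Proof.
case: x => i [al be] /=; rewrite -[X in (_ <= X)%N]card_ord.
apply: leq_trans (leq_imset_card (fun ga : 'I_(c i) => existT _ i (al, be, ga) : mm_term a b c) _).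
apply/subset_leq_card/fintype.subsetP => -[j [[al' be'] ga]]; rewrite inE => /eqP eq_x.
have eq_j := congr1 tag eq_x; rewrite /= in eq_j; subst j.
move/eqP: eq_x; rewrite eq_Tagged => /eqP[-> ->].
by apply/imsetP; exists ga.
Qed.

Lemma card_termY (y : mmY b c) : (#|[pred e : mm_term a b c | termY e == y]| <= a (tag y))%N.
Proof.
case: y => i [be ga] /=; rewrite -[X in (_ <= X)%N]card_ord.
apply: leq_trans (leq_imset_card (fun al : 'I_(a i) => existT _ i (al, be, ga) : mm_term a b c) _).
apply/subset_leq_card/fintype.subsetP => -[j [[al be'] ga']]; rewrite inE => /eqP eq_y.
have eq_j := congr1 tag eq_y; rewrite /= in eq_j; subst j.
move/eqP: eq_y; rewrite eq_Tagged => /eqP[-> ->].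
by apply/imsetP; exists al.
Qed.

Lemma card_termZ (z : mmZ a c) : (#|[pred e : mm_term a b c | termZ e == z]| <= b (tag z))%N.
Proof.
case: z => i [ga al] /=; rewrite -[X in (_ <= X)%N]card_ord.
apply: leq_trans (leq_imset_card (fun be : 'I_(b i) => existT _ i (al, be, ga) : mm_term a b c) _).
apply/subset_leq_card/fintype.subsetP => -[j [[al' be] ga']]; rewrite inE => /eqP eq_z.
have eq_j := congr1 tag eq_z; rewrite /= in eq_j; subst j.
move/eqP: eq_z; rewrite eq_Tagged => /eqP[-> ->].
by apply/imsetP; exists be.
Qed.

(** Double counting. Each tag sequence in [S] carries [A * B * C] term sequences, while an x-slice
    holds at most [C] of these, a y-slice at most [A] and a z-slice at most [B]: the index missing
    from the variable is the only free one. *)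
Lemma cover_card_le (A B C : nat) (S : {set {ffun 'I_n -> 'I_m}})
    (JX : {set {ffun 'I_n -> mmX a b}}) (JY : {set {ffun 'I_n -> mmY b c}})
    (JZ : {set {ffun 'I_n -> mmZ a c}}) :
  (forall s, s \in S ->
     [/\ \prod_t a (s t) = A, \prod_t b (s t) = B & \prod_t c (s t) = C]%N) ->
  (forall e : {ffun 'I_n -> mm_term a b c}, [|| [ffun t => termX (e t)] \in JX,
     [ffun t => termY (e t)] \in JY | [ffun t => termZ (e t)] \in JZ]) ->
  (#|S| * (A * B * C) <= #|JX| * C + #|JY| * A + #|JZ| * B)%N.
Proof.
move=> prodS cov.
pose E : {set {ffun 'I_n -> mm_term a b c}} :=
  [set e : {ffun 'I_n -> mm_term a b c} | [ffun t => tag (e t)] \in S].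
have <- : #|E| = (#|S| * (A * B * C))%N.
  rewrite -sum1_card.
  rewrite (partition_big (fun e : {ffun 'I_n -> mm_term a b c} => [ffun t => tag (e t)])
    (mem S)) /=; last first.
    by move=> e; rewrite inE.
  rewrite -sum_nat_const; apply: eq_bigr => s sS; rewrite sum1_card.
  have [<- <- <-] := prodS s sS; rewrite -!big_split /=.
  under [RHS]eq_bigr do rewrite -card_term_tag.
  rewrite -card_family_prod; apply: eq_card => e; rewrite !inE.
  apply/andP/familyP => [[_ /eqP def_s] t|tag_e].
    by rewrite inE -def_s ffunE.
  suff def_s : [ffun t => tag (e t)] = s.
    by rewrite inE def_s sS.
  by apply/ffunP => t; rewrite ffunE; apply/eqP/tag_e.
have leX := @card_preim_pow_le m n C _ _ tag tag c (@termX m a b c) S JX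
  (fun=> erefl) card_termX (fun s sS => let: And3 _ _ e := prodS s sS in e).
have leY := @card_preim_pow_le m n A _ _ tag tag a (@termY m a b c) S JY
  (fun=> erefl) card_termY (fun s sS => let: And3 e _ _ := prodS s sS in e).
have leZ := @card_preim_pow_le m n B _ _ tag tag b (@termZ m a b c) S JZ
  (fun=> erefl) card_termZ (fun s sS => let: And3 _ e _ := prodS s sS in e).
apply: leq_trans (leq_add (leq_add leX leY) leZ).
apply: leq_trans (leq_add (leq_card_setU _ _) (leqnn _)).
apply: leq_trans (leq_card_setU _ _).
apply/subset_leq_card/fintype.subsetP => e; rewrite !inE => eS.
by rewrite eS /= -orbA; exact: cov.
Qed.

End Count.

(** * From weights on the variables to bounds on degenerations *)

Definition subprobability (R : realType) (A : finType) (u : A -> R) : Prop :=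
  (forall x, 0 < u x) /\ \sum_x u x <= 1.

(* Bounds the asymptotic slice rank of T by s; used with the weights q_i / |X_i|. *)
Definition weight_cover (R : realType) (F : fieldType) (X Y Z : finType)
    (T : tensor F X Y Z) (q : nat) (s : R) : Prop :=
  exists (u : 'I_q -> X -> R) (v : 'I_q -> Y -> R) (w : 'I_q -> Z -> R),
    [/\ forall k, subprobability (u k), forall k, subprobability (v k),
        forall k, subprobability (w k)
      & forall (I : finType) (x : I -> X) (y : I -> Y) (z : I -> Z), (0 < #|I|)%N ->
          (forall t, T (x t) (y t) (z t) != 0) ->
          exists k, 1 <= (\prod_t u k (x t)) * (\prod_t v k (y t)) * (\prod_t w k (z t))
             * s ^+ (3 * #|I|)].

Lemma subprobability_pow (R : realType) (A : finType) (u : A -> R) (n : nat) :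
  subprobability u ->
  subprobability (fun x : {ffun 'I_n -> A} => \prod_i u (x i)).
Proof.
move=> [u_gt0 sum_u]; split=> [x|]; first exact: prodr_gt0.
rewrite -(bigA_distr_bigA (fun _ => u)) /= prodr_const card_ord exprn_ile1 //.
by apply: sumr_ge0 => x _; exact: ltW.
Qed.

(** A family of terms of the power indexed by [I] is a family of terms of [T] indexed by [I * 'I_n].
    Allowing any finite index type in [weight_cover] makes this direct. *)
Lemma weight_cover_pow (R : realType) (F : fieldType) (X Y Z : finType)
    (T : tensor F X Y Z) (q n : nat) (s : R) :
  (0 < n)%N -> weight_cover T q s -> weight_cover (tensor_pow T n) q (s ^+ n).
Proof.
move=> n_gt0 [u [v [w [pu pv pw cov]]]].
exists (fun k (x : {ffun 'I_n -> X}) => \prod_i u k (x i)),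
  (fun k (y : {ffun 'I_n -> Y}) => \prod_i v k (y i)),
  (fun k (z : {ffun 'I_n -> Z}) => \prod_i w k (z i)).
split; try by move=> k; exact: subprobability_pow.
move=> I x y z I_gt0 nz.
have [||k] := cov (I * 'I_n)%type (fun t => x t.1 t.2) (fun t => y t.1 t.2) (fun t => z t.1 t.2).
- by rewrite card_prod card_ord muln_gt0 I_gt0.
- move=> [t i] /=; have := nz t; rewrite /tensor_pow prodf_seq_neq0 => /allP/(_ i).
  by apply; rewrite mem_index_enum.
have pairE (D : finType) (g : D -> R) (f : I -> {ffun 'I_n -> D}) :
    \prod_(p : I * 'I_n) g (f p.1 p.2) = \prod_t \prod_i g (f t i).
  by rewrite pair_bigA.
rewrite card_prod card_ord (pairE _ (u k) x) (pairE _ (v k) y) (pairE _ (w k) z) => le1.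
exists k; apply: le_trans le1 _.
by rewrite -exprM (mulnCA n) (mulnC n).
Qed.

(** Markov's inequality, summed over the [q] weights. *)
Lemma card_heavy_le (R : realType) (A : finType) (q : nat) (u : 'I_q -> A -> R) (th : R) :
  (forall k, subprobability (u k)) ->
  #|[set x | [exists k, th <= u k x]]|%:R * th <= q%:R.
Proof.
move=> pu; have -> : q%:R = \sum_(k < q) 1 :> R by rewrite sumr_const card_ord.
apply: le_trans (_ : \sum_(k < q) \sum_x u k x <= _); last first.
  by apply: ler_sum => k _; have [] := pu k.
rewrite exchange_big mulr_natl -sumr_const.
rewrite [leRHS](bigID (mem [set x | [exists k, th <= u k x]])) /=.
rewrite -[leLHS]addr0; apply: lerD.
  apply: ler_sum => x; rewrite inE => /existsP[k le_u]; rewrite (bigD1 k) //=.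
  rewrite -[leLHS]addr0; apply: lerD => //.
  by apply: sumr_ge0 => k' _; have [pos _] := pu k'; exact: ltW.
apply: sumr_ge0 => x _; apply: sumr_ge0 => k _; have [pos _] := pu k; exact: ltW.
Qed.

Section ClassBound.
Variables (R : realType) (F : fieldType) (X Y Z : finType) (T : tensor F X Y Z).
Variables (q m : nat) (s : R) (a b c : 'I_m -> nat).
Hypothesis s_gt0 : 0 < s.
Hypothesis cov : weight_cover T q s.
Hypothesis deg : degenerates T (@mm_sum F m a b c).

(** The variables of weight above suitable thresholds cover all terms of the n-th power of [T]. The
    cover passes down to the power of the direct sum, where it is compared with the count of terms
    over [S]. *)
Lemma tag_class_le (n A B C : nat) (be : R) (S : {set {ffun 'I_n -> 'I_m}}) :
  (0 < n)%N -> 0 < be -> be ^+ 3 = (A * B * C)%:R ->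
  (forall t, t \in S ->
     [/\ \prod_i a (t i) = A, \prod_i b (t i) = B & \prod_i c (t i) = C]%N) ->
  #|S|%:R * be ^+ 2 <= 3 * q%:R * s ^+ n.
Proof.
move=> n_gt0 be_gt0 be3 prodS.
have [u [v [w [pu pv pw wcov]]]] := cov.
have : (0 < A * B * C)%N by rewrite -(ltr_nat R) -be3 exprn_gt0.
rewrite !muln_gt0 -(ltr_nat R) -(ltr_nat R _ B) -(ltr_nat R _ C).
rewrite !natrM in be3 *.
set A' := A%:R in be3 *; set B' := B%:R in be3 *; set C' := C%:R in be3 *.
move=> /andP[/andP[A_gt0 B_gt0] C_gt0].
have sn_gt0 : 0 < s ^+ n by rewrite exprn_gt0.
pose heavy (D : finType) (u : 'I_q -> D -> R) (th : R) : {set {ffun 'I_n -> D}} :=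
  [set x : {ffun 'I_n -> D} | [exists k, th <= \prod_i u k (x i)]].
(* The thresholds are balanced: their product times [s ^+ (3 * n)] is 1, so a term whose three
   variables are all light would contradict the weight cover. Moreover [q / thX * C], [q / thY * A]
   and [q / thZ * B] all equal [q * s ^+ n * be]. *)
pose thX := be ^+ 2 / (A' * B' * s ^+ n).
pose thY := be ^+ 2 / (B' * C' * s ^+ n).
pose thZ := be ^+ 2 / (C' * A' * s ^+ n).
have [thX0 thY0 thZ0] : [/\ 0 < thX, 0 < thY & 0 < thZ].
  by split; rewrite divr_gt0 ?exprn_gt0 ?mulr_gt0.
have th1 : thX * thY * thZ * s ^+ (3 * n) = 1.
  rewrite mulnC exprM /thX /thY /thZ.
  have -> : be ^+ 2 / (A' * B' * s ^+ n) * (be ^+ 2 / (B' * C' * s ^+ n)) *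
    (be ^+ 2 / (C' * A' * s ^+ n)) * s ^+ n ^+ 3 = (be ^+ 3) ^+ 2 / (A' * B' * C') ^+ 2.
    by field; rewrite !gt_eqF.
  by rewrite be3 divff // gt_eqF // exprn_gt0 // !mulr_gt0.
have supp x y z : tensor_pow T n x y z != 0 ->
    [|| x \in heavy X u thX, y \in heavy Y v thY | z \in heavy Z w thZ].
  rewrite /tensor_pow prodf_seq_neq0 => /allP nz.
  have [||k] := wcov 'I_n x y z; first by rewrite card_ord.
    by move=> t; have := nz t; rewrite mem_index_enum; apply.
  rewrite card_ord => le1; rewrite !inE; apply/negPn/negP.
  rewrite !negb_or => /and3P[/existsPn/(_ k) + /existsPn/(_ k) + /existsPn/(_ k)].
  rewrite -!ltNge => ltx lty ltz.
  suff : 1 < 1 :> R by rewrite ltxx.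
  apply: le_lt_trans le1 _; rewrite -[ltRHS]th1 ltr_pM2r ?exprn_gt0 //.
  have /ltW ux := (subprobability_pow n (pu k)).1 x.
  have /ltW vy := (subprobability_pow n (pv k)).1 y.
  have /ltW wz := (subprobability_pow n (pw k)).1 z.
  have uv := mulr_ge0 ux vy; have lt_uv := ltr_pM ux vy ltx lty.
  exact: ltr_pM uv wz lt_uv ltz.
have [f [g [h anti]]] := @mm_sum_antichain F m a b c.
have [JX [JY [JZ [leX leY leZ covJ]]]] :=
  degeneration_support_cover (antichain_pow n anti) (degenerates_pow n deg) supp.
have := @cover_card_le m n a b c A B C S JX JY JZ prodS.
have Jcov (e : {ffun 'I_n -> mm_term a b c}) : [|| [ffun t => termX (e t)] \in JX,
     [ffun t => termY (e t)] \in JY | [ffun t => termZ (e t)] \in JZ].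
  apply: covJ; rewrite /tensor_pow prodf_seq_neq0; apply/allP => t _; rewrite !ffunE /=.
  by apply/mm_sum_neq0; exists (e t).
move=> /(_ Jcov); rewrite -(ler_nat R) !natrD !natrM -/A' -/B' -/C'.
have hX : #|JX|%:R * thX <= q%:R.
  apply: le_trans (card_heavy_le thX (fun k => subprobability_pow n (pu k))).
  by rewrite ler_pM2r // ler_nat.
have hY : #|JY|%:R * thY <= q%:R.
  apply: le_trans (card_heavy_le thY (fun k => subprobability_pow n (pv k))).
  by rewrite ler_pM2r // ler_nat.
have hZ : #|JZ|%:R * thZ <= q%:R.
  apply: le_trans (card_heavy_le thZ (fun k => subprobability_pow n (pw k))).
  by rewrite ler_pM2r // ler_nat.
have bound (J D th : R) : 0 < D -> th = be ^+ 2 * D / (A' * B' * C' * s ^+ n) ->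
    J * th <= q%:R -> J * D <= q%:R * s ^+ n * be.
  move=> D0 -> le_q; have -> : J * D = J * (be ^+ 2 * D / (A' * B' * C' * s ^+ n)) * (s ^+ n * be).
    by rewrite -be3; field; rewrite !gt_eqF.
  by rewrite -[leRHS]mulrA ler_pM2r // mulr_gt0.
have {}hX := bound _ C' _ C_gt0 _ hX; have {}hY := bound _ A' _ A_gt0 _ hY.
have {}hZ := bound _ B' _ B_gt0 _ hZ.
rewrite -be3 => le_S; rewrite -(ler_pM2r be_gt0).
have -> : #|S|%:R * be ^+ 2 * be = #|S|%:R * be ^+ 3 by ring.
apply: le_trans le_S _.
have -> : 3 * q%:R * s ^+ n * be = q%:R * s ^+ n * be + q%:R * s ^+ n * be + q%:R * s ^+ n * be.
  by ring.
by apply: lerD; [apply: lerD|]; [apply: hX|apply: hY|apply: hZ];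
  rewrite /thX /thY /thZ; field; rewrite !gt_eqF.
Qed.

(** Expand the power over tag sequences and group these by type, the number of occurrences of each
    tag. There are at most [n.+1 ^ m] types, and within one type the products of the dimensions are
    constant, so [tag_class_le] applies. *)
Lemma sum_cuberoot_pow_le (n : nat) (rho : 'I_m -> R) :
  (0 < n)%N -> (forall i, 0 < rho i) -> (forall i, rho i ^+ 3 = (a i * b i * c i)%:R) ->
  (\sum_i rho i ^+ 2) ^+ n <= n.+1%:R ^+ m * (3 * q%:R * s ^+ n).
Proof.
move=> n_gt0 rho_gt0 rho3.
have -> : (\sum_i rho i ^+ 2) ^+ n = \prod_(t < n) \sum_i rho i ^+ 2.
  by rewrite prodr_const card_ord.
rewrite bigA_distr_bigA /=.
(* Every count is at most n, so [inord] never falls back to its default. *)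
pose type (t : {ffun 'I_n -> 'I_m}) : {ffun 'I_m -> 'I_n.+1} :=
  [ffun i => inord #|[pred j | t j == i]|].
have prod_type (M : comNzSemiRingType) (f : 'I_m -> M) (t : {ffun 'I_n -> 'I_m}) :
    \prod_j f (t j) = \prod_i f i ^+ type t i.
  rewrite (partition_big t predT) //=; apply: eq_bigr => i _.
  rewrite ffunE inordK; last by rewrite ltnS -[leqRHS]card_ord max_card.
  rewrite -prodr_const; apply: eq_big => // j /eqP -> //.
rewrite (partition_big type predT) //=.
have -> : n.+1%:R ^+ m * (3 * q%:R * s ^+ n) = \sum_(ty : {ffun 'I_m -> 'I_n.+1}) 3 * q%:R * s ^+ n.
  by rewrite sumr_const card_ffun !card_ord -[RHS]mulr_natl natrX.
apply: ler_sum => ty _.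
pose S : {set {ffun 'I_n -> 'I_m}} := [set t | type t == ty].
pose be := \prod_i rho i ^+ ty i.
have be_gt0 : 0 < be by apply: prodr_gt0 => i _; rewrite exprn_gt0.
apply: le_trans (@tag_class_le n (\prod_i a i ^ ty i)%N (\prod_i b i ^ ty i)%N
  (\prod_i c i ^ ty i)%N be S n_gt0 be_gt0 _ _).
- rewrite mulr_natl -sumr_const le_eqVlt; apply/orP; left; apply/eqP.
  apply: eq_big => [t|t /eqP eq_ty]; first by rewrite inE.
  by rewrite prodrXl prod_type eq_ty.
- rewrite /be -!big_split /= natr_prod -prodrXl; apply: eq_bigr => i _.
  by rewrite -exprM mulnC exprM rho3 -natrX !expnMn.
- move=> t; rewrite inE => /eqP <-.
  by split; rewrite (prod_type nat).
Qed.

End ClassBound.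

(** * Removing subexponential factors *)

Lemma bernoulli_ge (R : realType) (d : R) (n : nat) : 0 <= d -> 1 + d *+ n <= (1 + d) ^+ n.
Proof.
move=> d0; elim: n => [|n IHn]; first by rewrite mulr0n addr0.
rewrite exprS mulrS; apply: le_trans (ler_wpM2l _ IHn); last lra.
have : 0 <= d * (d *+ n) by rewrite mulr_ge0 // mulrn_wge0.
lra.
Qed.

(** If x = (1 + d) y with d > 0, take the exponent M (m + 1). By Bernoulli the left side grows at
    least like (M d)^(m+1), the polynomial factor only like M^m, so M is bounded, against the
    Archimedean property. *)
Lemma le_of_subexp_growth (R : realType) (m : nat) (K x y : R) : 0 < y ->
  (forall n, (0 < n)%N -> x ^+ n <= n.+1%:R ^+ m * (K * y ^+ n)) -> x <= y.
Proof.
move=> y_gt0 le_pow; rewrite leNgt; apply/negP => lt_yx.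
have [d [d_gt0 def_x]] : exists d, 0 < d /\ x = (1 + d) * y.
  exists (x / y - 1); rewrite subr_gt0 ltr_pdivlMr // mul1r; split=> //.
  by rewrite addrC subrK divfK // gt_eqF.
have bound M : (0 < M)%N -> M%:R * d ^+ m.+1 <= m.+2%:R ^+ m * K.
  move=> M_gt0; have n_gt0 : (0 < M * m.+1)%N by rewrite muln_gt0 M_gt0.
  have M0 : 0 < M%:R :> R by rewrite ltr0n.
  have := le_pow _ n_gt0; rewrite def_x exprMn mulrA ler_pM2r ?exprn_gt0 // => le1.
  have K_ge0 : 0 <= K.
    have : 0 <= (M * m.+1).+1%:R ^+ m * K by apply: le_trans _ le1; apply: exprn_ge0; lra.
    by rewrite pmulr_rge0 // exprn_gt0 // ltr0n.
  rewrite -(ler_pM2l (exprn_gt0 m M0)).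
  apply: (@le_trans _ _ ((M%:R * d) ^+ m.+1)).
    by rewrite exprMn mulrA -exprSr.
  apply: (@le_trans _ _ ((1 + d) ^+ (M * m.+1))).
    rewrite exprM; apply: lerXn2r; rewrite ?nnegrE.
    - by rewrite mulr_ge0 // ltW.
    - by apply: exprn_ge0; lra.
    by apply: le_trans (bernoulli_ge M (ltW d_gt0)); rewrite mulr_natl lerDr.
  apply: le_trans le1 _; rewrite mulrA -exprMn ler_wpM2r //.
  apply: lerXn2r; rewrite ?nnegrE ?mulr_ge0 // -natrM ler_nat.
  by rewrite mulnS [(M * m.+2)%N]mulnS [(M * m.+1)%N]mulnS; lia.
have e_gt0 : 0 < d ^+ m.+1 by rewrite exprn_gt0.
pose B := m.+2%:R ^+ m * K / d ^+ m.+1.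
have [n n_gt] : exists n : nat, `|B| < n%:R.
  by exists (Num.bound `|B|); apply: archi_boundP.
have : n.+1%:R <= B by rewrite /B ler_pdivlMr // bound.
have := ler_norm B; have : n%:R <= n.+1%:R :> R by rewrite ler_nat.
lra.
Qed.

(** * Compactness: finitely many linear forms suffice *)

HB.instance Definition _ (R : realType) (I : finType) :=
  Pointed.copy {ptws I -> R} (I -> R).

Section LinearCover.
Local Open Scope classical_set_scope.
Variables (R : realType) (I : finType).

Lemma linear_form_continuous (al : I -> R) :
  continuous (fun p : {ptws I -> R} => \sum_t al t * p t).
Proof.
elim: (index_enum I) => [|t r IHr].
  have -> : (fun p : {ptws I -> R} => \sum_(t <- [::]) al t * p t) = fun=> 0.
    by apply/funext => q; rewrite big_nil.
  exact: cst_continuous.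
have -> : (fun p : {ptws I -> R} => \sum_(t <- t :: r) al t * p t)
    = fun q : {ptws I -> R} => al t * q t + \sum_(t <- r) al t * q t.
  by apply/funext => q; rewrite big_cons.
move=> p; apply: cvgD (IHr p); apply: cvgM; first exact: (@cst_continuous {ptws I -> R} R (al t) p).
exact: (@proj_continuous I (fun=> R) t p).
Qed.

(** Makes a pointwise strict bound uniform. [K] is closed in a cube, hence compact by Tychonoff, and
    is covered by the open half-spaces with a form from [D] and a threshold below [y]. The largest
    threshold of a finite subcover is [y']. *)
Lemma linear_form_finite_cover (K : set {ptws I -> R}) (D : set (I -> R)) (y : R) :
  closed K -> (forall p, K p -> forall t, 0 <= p t <= 1) ->
  (forall p, K p -> exists2 al, D al & \sum_t al t * p t < y) ->
  exists (y' : R) (s : seq (I -> R)), [/\ y' < y, forall i, (i < size s)%N -> D (nth (fun=> 0) s i)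
    & forall p, K p -> exists2 i, (i < size s)%N & \sum_t nth (fun=> 0) s i t * p t <= y'].
Proof.
move=> clK boxK coverK.
have cpt : compact K.
  apply: (subclosed_compact clK
    (@tychonoff I (fun=> R) (fun=> `[0, 1]) (fun=> @segment_compact _ 0 1))).
  by move=> p Kp t /=; rewrite in_itv /= boxK.
have {}cpt : cover_compact K by rewrite -(@compact_cover {ptws I -> R}).
pose f (ay : (I -> R) * R) : set {ptws I -> R} := [set p | \sum_t ay.1 t * p t < ay.2].
have [| |D' D'D covD'] := cpt _ [set ay : (I -> R) * R | D ay.1 /\ ay.2 < y] f.
- move=> [al z] _; rewrite /f /=.
  exact: (open_comp (fun p _ => @linear_form_continuous al p) (@open_lt _ z)).
- move=> p /coverK[al Dal lt_y]; exists (al, (\sum_t al t * p t + y) / 2).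
    by split=> //=; lra.
  by rewrite /f /=; lra.
pose s := enum_fset D'.
have y'P : exists2 y', y' < y & forall ay, ay \in s -> ay.2 <= y'.
  have : forall ay, ay \in s -> ay.2 < y by move=> ay /D'D/set_mem[].
  elim: s => [_|ay s IHs lt_s]; first by exists (y - 1); [lra | by []].
  have [|y' lt_y' le_y'] := IHs; first by move=> bz bs; rewrite lt_s // inE bs orbT.
  exists (Num.max ay.2 y'); first by rewrite gt_max lt_s ?inE ?eqxx.
  by move=> bz; rewrite inE le_max => /predU1P[->|/le_y' ->]; rewrite ?lexx ?orbT.
have [y' lt_y' le_y'] := y'P; exists y', (map fst s); split=> // [i|p /covD'[ay /= ays]].
  rewrite size_map => lt_i; rewrite (nth_map ((fun=> 0), 0)) //.
  by have /D'D/set_mem[] := mem_nth (fun=> 0, 0) lt_i.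
rewrite /f /= => lt_p; exists (index ay s).
  by rewrite size_map index_mem.
rewrite (nth_map ((fun=> 0), 0)) ?index_mem // nth_index //.
exact: le_trans (ltW lt_p) (le_y' _ ays).
Qed.

End LinearCover.

(** * Symmetric distributions, their empirical instances and their optimal weights *)

Lemma ln_prodr (R : realType) (I : finType) (P : pred I) (f : I -> R) :
  (forall i, P i -> 0 < f i) -> ln (\prod_(i | P i) f i) = \sum_(i | P i) ln (f i).
Proof.
move=> f_gt0; suff [] : 0 < \prod_(i | P i) f i /\
  ln (\prod_(i | P i) f i) = \sum_(i | P i) ln (f i) by [].
elim/big_ind2 : _ => [|x1 x2 y1 y2 [x1_gt0 <-] [y1_gt0 <-]|i Pi].
- by rewrite ln1.
- by rewrite mulr_gt0 // lnM.
- by rewrite f_gt0.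
Qed.

Section Rotation.
Variable k : nat.

Definition rot3 (t : 'I_k * 'I_k * 'I_k) : 'I_k * 'I_k * 'I_k := (t.1.2, t.2, t.1.1).

Lemma rot3K t : rot3 (rot3 (rot3 t)) = t.
Proof. by case: t => -[i j] l. Qed.

Lemma rot3_eq t t' : (t == rot3 t') = (rot3 (rot3 t) == t').
Proof. by apply/eqP/eqP => [->|<-]; rewrite rot3K. Qed.

End Rotation.

Lemma sum_mul_eq (R : realType) (I : finType) (g : I -> R) (u : I) :
  \sum_t g t * (u == t)%:R = g u.
Proof.
rewrite (bigD1 u) //= eqxx mulr1 big1 ?addr0 // => t /negbTE.
by rewrite eq_sym => ->; rewrite mulr0.
Qed.

Section Empirical.
Variables (R : realType) (k : nat) (L : {set 'I_k * 'I_k * 'I_k}).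
Hypothesis L_rot : forall t, t \in L -> rot3 t \in L.

(** Averaging the empirical distribution of [b] over the three rotations makes it symmetric, and a
    form that reads only the first index then sees all three indices of each [b i]. *)
Lemma empirical_sym_distr (I : finType) (b : I -> 'I_k * 'I_k * 'I_k) :
  (0 < #|I|)%N -> (forall t, b t \in L) ->
  exists2 p : 'I_k * 'I_k * 'I_k -> R, sym_distr L p &
    forall al : 'I_k -> R, (3 * #|I|)%:R * \sum_t al t.1.1 * p t
      = \sum_i (al (b i).1.1 + al (b i).1.2 + al (b i).2).
Proof.
move=> I_gt0 bL; pose N : R := (3 * #|I|)%:R.
have N_gt0 : 0 < N by rewrite ltr0n muln_gt0.
pose p t : R := N^-1 * \sum_i ((b i == t)%:R + (b i == rot3 t)%:R + (b i == rot3 (rot3 t))%:R).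
have lin (al : 'I_k -> R) : N * \sum_t al t.1.1 * p t
      = \sum_i (al (b i).1.1 + al (b i).1.2 + al (b i).2).
  rewrite mulr_sumr; under eq_bigr => t _.
    rewrite /p mulrCA mulVKf ?gt_eqF // mulr_sumr.
    over.
  rewrite exchange_big; apply: eq_bigr => i _ /=.
  under eq_bigr do rewrite !mulrDr.
  rewrite !big_split /= (sum_mul_eq (fun t => al t.1.1)).
  under [X in _ + X + _ = _]eq_bigr do rewrite rot3_eq.
  under [X in _ + _ + X = _]eq_bigr do rewrite !rot3_eq rot3K.
  by rewrite !(sum_mul_eq (fun t => al t.1.1)) /= -addrA [X in _ + X]addrC addrA.
have p0 t : t \notin L -> p t = 0.
  move=> tL; have bne t' : (t' \in L -> t \in L) -> forall i, (b i == t') = false.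
    by move=> t'L i; apply: contraNF tL => /eqP def_t'; apply: t'L; rewrite -def_t' bL.
  rewrite /p big1 ?mulr0 // => i _; rewrite !bne ?addr0 //.
    by move=> tL'; rewrite -(rot3K t); apply: L_rot.
  by move=> tL'; rewrite -(rot3K t); apply/L_rot/L_rot.
exists p => //; split=> //.
- move=> t; apply: mulr_ge0; first by rewrite invr_ge0 ltW.
  by apply: sumr_ge0 => i _; rewrite !addr_ge0.
- have := lin (fun=> 1); rewrite sumr_const => sum_p; apply: (@mulfI _ N); first by rewrite gt_eqF.
  rewrite mulr1; transitivity (N * \sum_t 1 * p t).
    congr (_ * _); rewrite [RHS](bigID (mem L)) /= [X in _ = _ + X]big1 ?addr0.
      by apply: eq_bigr => t _; rewrite mul1r.
    by move=> t /p0 ->; rewrite mulr0.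
  by rewrite sum_p /N mulnC natrM mulr_natl; congr (_ *+ _); ring.
- move=> i j l; rewrite -/(rot3 (i, j, l)) /p rot3K; congr (_ * _).
  by apply: eq_bigr => e _; rewrite -addrA addrC.
Qed.

(** Every defining condition is an equality or a weak inequality for a linear form, so the set is an
    intersection of closed preimages. *)
Lemma closed_sym_distr :
  closed ([set p | sym_distr L p]%classic : set {ptws ('I_k * 'I_k * 'I_k)%type -> R}).
Proof.
pose form (al p : 'I_k * 'I_k * 'I_k -> R) := \sum_t al t * p t.
have closed_form_eq al y : closed ([set p | form al p = y]%classic :
    set {ptws ('I_k * 'I_k * 'I_k)%type -> R}).
  have /continuous_closedP := @linear_form_continuous R ('I_k * 'I_k * 'I_k)%type al.
  exact: (fun H => H _ (@closed_eq _ y)).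
have closed_form_ge al y : closed ([set p | y <= form al p]%classic :
    set {ptws ('I_k * 'I_k * 'I_k)%type -> R}).
  have /continuous_closedP := @linear_form_continuous R ('I_k * 'I_k * 'I_k)%type al.
  exact: (fun H => H _ (@closed_ge _ y)).
pose ev t : 'I_k * 'I_k * 'I_k -> R := fun t' => (t == t')%:R.
have evE t p : form (ev t) p = p t.
  by rewrite /form -[RHS](sum_mul_eq p); apply: eq_bigr => t' _; rewrite mulrC.
rewrite (_ : mkset _ = (\bigcap_t [set p | 0 <= form (ev t) p]
  `&` \bigcap_(t in [set t | t \notin L]) [set p | form (ev t) p = 0]
  `&` [set p | form (fun t => (t \in L)%:R) p = 1]
  `&` \bigcap_t [set p | form (fun t' => ev t t' - ev (rot3 t) t') p = 0])%classic).
  apply: closedI; [apply: closedI; [apply: closedI|]|].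
  - by apply: closed_bigI.
  - by apply: closed_bigI.
  - by [].
  - by apply: closed_bigI.
have sumE p : form (fun t => (t \in L)%:R) p = \sum_(t in L) p t.
  by rewrite /form [RHS]big_mkcond; apply: eq_bigr => t _; case: (t \in L); rewrite ?mul1r ?mul0r.
have subE t p : form (fun t' => ev t t' - ev (rot3 t) t') p = p t - p (rot3 t).
  rewrite -(evE t) -(evE (rot3 t)) /form -sumrB.
  by apply: eq_bigr => t' _; rewrite mulrBl.
apply/seteqP; split=> p /=.
  case=> p_ge0 p_out sum_p p_rot; split; [split; [split|]|].
  - by move=> t _ /=; rewrite evE.
  - by move=> t tL /=; rewrite evE p_out.
  - by rewrite sumE.
  - by move=> [[i j] l] _ /=; rewrite subE /rot3 /= p_rot subrr.
case=> -[[p_ge0 p_out] sum_p] p_rot; split.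
- by move=> t; have := p_ge0 t I; rewrite /= evE.
- by move=> t tL; have := p_out t tL; rewrite /= evE.
- by rewrite -sumE.
- move=> i j l; have := p_rot (i, j, l) I; rewrite /= subE => /eqP.
  by rewrite subr_eq0 => /eqP.
Qed.

Lemma sym_distr_le1 (p : 'I_k * 'I_k * 'I_k -> R) : sym_distr L p -> forall t, 0 <= p t <= 1.
Proof.
case=> p_ge0 p_out sum_p _ t; rewrite p_ge0 /=.
have [tL|/p_out -> //] := boolP (t \in L).
by rewrite -sum_p (bigD1 t) //= lerDl; apply: sumr_ge0.
Qed.

(** For v_i = p(X_i) / |X_i| the form would take the value ln (C_p A_p) at p: the entropy of the
    marginal plus the mean of ln |X_i|. A slight perturbation makes all v_i positive within the
    strict slack. *)
Lemma laser_weights (X : finType) (PX : 'I_k -> {set X}) (r : R)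
    (p : 'I_k * 'I_k * 'I_k -> R) :
  sym_distr L p -> (forall t, t \in L -> (0 < #|PX t.1.1|)%N) ->
  laser_C L p * laser_A L PX p < r ->
  exists v : 'I_k -> R, [/\ forall i, 0 < v i, \sum_i #|PX i|%:R * v i <= 1
    & \sum_t - ln (v t.1.1) * p t < ln r].
Proof.
move=> [p_ge0 p_out sum_p _] PX_gt0 lt_r.
pose mu := marginal L p.
have mu_ge0 i : 0 <= mu i by apply: sumr_ge0.
have mu_gt0 t : t \in L -> 0 < p t -> 0 < mu t.1.1.
  move=> tL pt; rewrite /mu /marginal (bigD1 t) /= ?tL //=.
  by apply: ltr_pwDl => //; apply: sumr_ge0.
have sum_mu (g : 'I_k -> R) : \sum_(t in L) g t.1.1 * p t = \sum_i g i * mu i.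
  rewrite (partition_big (fun t => t.1.1) predT) //=; apply: eq_bigr => i _.
  by rewrite mulr_sumr; apply: eq_bigr => t /andP[_ /eqP ->].
(* A part of marginal 0 contributes the factor 0 to the power 0, which is 1. *)
have powC_gt0 i : 0 < mu i `^ (- mu i).
  have := mu_ge0 i; rewrite le_eqVlt => /predU1P[<-|]; last exact: powR_gt0.
  by rewrite oppr0 powRr0.
have powA_gt0 t : t \in L -> 0 < #|PX t.1.1|%:R `^ p t.
  by move=> tL; rewrite powR_gt0 // ltr0n PX_gt0.
have C_gt0 : 0 < laser_C L p by apply: prodr_gt0.
have A_gt0 : 0 < laser_A L PX p by apply: prodr_gt0.
have lnC : ln (laser_C L p) = - \sum_i ln (mu i) * mu i.
  rewrite ln_prodr // -sumrN; apply: eq_bigr => i _.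
  by rewrite ln_powR mulNr mulrC.
have lnA : ln (laser_A L PX p) = \sum_(t in L) ln #|PX t.1.1|%:R * p t.
  by rewrite ln_prodr //; apply: eq_bigr => t _; rewrite ln_powR mulrC.
have r_gt0 : 0 < r by apply: lt_trans lt_r; rewrite mulr_gt0.
have lt_ln : ln (laser_C L p) + ln (laser_A L PX p) < ln r.
  by rewrite -lnM ?posrE // ltr_ln ?posrE ?mulr_gt0.
set lC := ln (laser_C L p) in lnC lt_ln; set lA := ln (laser_A L PX p) in lnA lt_ln.
(* [- ln kap] is half the gap in [lt_ln], so adding it stays strictly below [ln r]. *)
pose kap := expR ((lC + lA - ln r) / 2).
have kap_gt0 : 0 < kap by exact: expR_gt0.
have kap_lt1 : kap < 1 by rewrite expR_lt1; lra.
have k_gt0 : 0 < k%:R :> R.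
  rewrite ltr0n lt0n; apply/eqP => k0.
  have : \sum_(t in L) p t = 0.
    by rewrite big1 // => -[[[i lt_i] ?] ?] _; exfalso; rewrite k0 in lt_i.
  by rewrite sum_p => /eqP; rewrite oner_eq0.
(* Mixing the marginal with the uniform distribution keeps all logarithms finite, at
   the price of the arbitrarily small constant - ln kap. *)
pose q i := kap * mu i + (1 - kap) / k%:R.
have q_gt0 i : 0 < q i.
  apply: ltr_wpDl; first by rewrite mulr_ge0 // ltW.
  by rewrite divr_gt0 // subr_gt0.
(* An empty part may get any positive weight, since its size cancels it in the sum. *)
pose v i := if (0 < #|PX i|)%N then q i / #|PX i|%:R else 1.
exists v; split.
- by move=> i; rewrite /v; case: ifP => // PXi; rewrite divr_gt0 // ltr0n.
- apply: le_trans (_ : \sum_i q i <= _).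
    apply: ler_sum => i _; rewrite /v; case: ifP => [PXi|].
      by rewrite mulrC divfK // pnatr_eq0 -lt0n.
    by rewrite lt0n => /negbFE/eqP ->; rewrite mul0r ltW.
  rewrite big_split /= -mulr_sumr sumr_const card_ord.
  have -> : \sum_i mu i = 1.
    by have := sum_mu (fun=> 1); rewrite -!mulr_sumr !mul1r sum_p => <-.
  by rewrite -[(_ / _) *+ k]mulr_natr divfK ?gt_eqF // mulr1 addrC subrK.
have -> : \sum_t - ln (v t.1.1) * p t = \sum_(t in L) - ln (v t.1.1) * p t.
  rewrite (bigID (mem L)) /= [X in _ + X]big1 ?addr0 // => t /p_out ->.
  by rewrite mulr0.
apply: (@le_lt_trans _ _ (\sum_(t in L)
    (ln #|PX t.1.1|%:R * p t - ln (mu t.1.1) * p t - ln kap * p t))).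
  apply: ler_sum => t tL; have := p_ge0 t; rewrite le_eqVlt => /predU1P[<-|pt].
    by rewrite !mulr0 !subr0.
  rewrite -!mulrBl ler_pM2r //.
  have PXt : 0 < #|PX t.1.1|%:R :> R by rewrite ltr0n PX_gt0.
  have mut := mu_gt0 t tL pt.
  rewrite /v PX_gt0 // ln_div ?posrE //.
  have : ln (kap * mu t.1.1) <= ln (q t.1.1).
    rewrite ler_ln ?posrE ?mulr_gt0 // /q lerDl.
    by rewrite ltW // divr_gt0 // subr_gt0.
  rewrite lnM ?posrE //; lra.
rewrite !sumrB -lnA (sum_mu (fun i => ln (mu i))) -mulr_sumr sum_p mulr1 expRK.
rewrite lnC in lt_ln *; lra.
Qed.

End Empirical.

(** * Weight covers from the partition *)

Lemma tensor_zeroPn (F : fieldType) (X Y Z : finType) (T : tensor F X Y Z) :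
  reflect (exists x y z, T x y z != 0) (~~ tensor_zero T).
Proof.
apply: (iffP idP) => [|[x [y [z nz]]]].
  by rewrite negb_forall => /existsP[x]; rewrite negb_forall => /existsP[y];
    rewrite negb_forall => /existsP[z]; exists x, y, z.
by apply: contra nz => /forallP/(_ x)/forallP/(_ y)/forallP/(_ z).
Qed.

Section Partitioned.
Variables (R : realType) (F : fieldType) (X Y Z : finType) (T : tensor F X Y Z) (k : nat).
Variables (PX : 'I_k -> {set X}) (PY : 'I_k -> {set Y}) (PZ : 'I_k -> {set Z}).
Let L := nonzero_blocks T PX PY PZ.

Lemma mem_nonzero_blocks i j l x y z : x \in PX i -> y \in PY j -> z \in PZ l ->
  T x y z != 0 -> (i, j, l) \in L.
Proof.
move=> xi yj zl nz; rewrite inE /=; apply/tensor_zeroPn; exists x, y, z.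
by rewrite /tensor_block xi yj zl.
Qed.

Lemma nonzero_blocks_card t : t \in L -> (0 < #|PX t.1.1|)%N.
Proof.
rewrite inE => /tensor_zeroPn[x [y [z]]]; rewrite /tensor_block.
by case: ifP => [/andP[xt _] _|]; [apply/card_gt0P; exists x | rewrite eqxx].
Qed.

Hypothesis sym : symmetric_partitions T PX PY PZ.

Lemma nonzero_blocks_rot t : t \in L -> rot3 t \in L.
Proof.
case: t => -[i j] l; rewrite !inE /= => /tensor_zeroPn[x [y [z nz]]].
have [f [g [h [[f' _ fK] [g' _ gK] [h' _ hK] eq_T]]]] := sym.2 i j l.
apply/tensor_zeroPn; exists (f' y), (g' z), (h' x).
by rewrite eq_T /tensor_rot fK gK hK.
Qed.

Hypotheses (partX : part_family PX) (partY : part_family PY) (partZ : part_family PZ).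

Lemma subprobability_part (A : finType) (P : 'I_k -> {set A}) (b : A -> 'I_k) (v : 'I_k -> R) :
  (forall x, x \in P (b x)) -> (forall i, 0 < v i) -> \sum_i #|P i|%:R * v i <= 1 ->
  subprobability (fun x => v (b x)).
Proof.
move=> bP v_gt0 sum_v; split=> [x|]; first exact: v_gt0.
apply: le_trans sum_v; rewrite (partition_big b predT) //=; apply: ler_sum => i _.
under eq_bigr => x /eqP bx do rewrite bx.
rewrite sumr_const -[leLHS]mulr_natl; apply: ler_wpM2r; first exact: ltW.
rewrite ler_nat.
by apply/subset_leq_card/fintype.subsetP => x; rewrite -[_ \in _]/(b x == i) => /eqP <-; exact: bP.
Qed.

(** Compactness leaves finitely many weights and a bound y < ln r, and s is [expR y]. For a family
    of terms, minus the logarithm of the product of all weights is 3|I| times the form at the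
    symmetrised empirical distribution, hence at most 3|I| y for one of the weights. *)
Lemma weight_cover_laser (r : R) :
  (forall p, sym_distr L p -> laser_C L p * laser_A L PX p < r) ->
  (exists p : _ -> R, sym_distr L p) ->
  exists (q : nat) (s : R), [/\ 0 < s, s < r & weight_cover T q s].
Proof.
move=> laser [p0 p0_sym].
have r_gt0 : 0 < r.
  apply: le_lt_trans (laser _ p0_sym); rewrite mulr_ge0 //; apply: prodr_ge0 => *; exact: powR_ge0.
pose D : set ('I_k * 'I_k * 'I_k -> R) := [set al | exists v : 'I_k -> R,
  [/\ forall i, 0 < v i, \sum_i #|PX i|%:R * v i <= 1 & al = fun t => - ln (v t.1.1)]]%classic.
have [||y [s [lt_y sD cov_s]]] :=
  linear_form_finite_cover (D := D) (y := ln r) (@closed_sym_distr R k L).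
- by move=> p /sym_distr_le1.
- move=> p p_sym; have [v [v_gt0 sum_v lt_r]] :=
    laser_weights p_sym nonzero_blocks_card (laser _ p_sym).
  by exists (fun t => - ln (v t.1.1)) => //; exists v.
have /choice[v vP] (i : 'I_(size s)) := sD i (ltn_ord i).
have [bx bxP] := choice partX.1; have [by_ byP] := choice partY.1.
have [bz bzP] := choice partZ.1.
exists (size s), (expR y); split; first exact: expR_gt0.
  by rewrite -[ltRHS]lnK ?posrE // ltr_expR.
(* One vector [v i] serves all three sides because corresponding parts have equal sizes. *)
exists (fun i x => v i (bx x)), (fun i x => v i (by_ x)), (fun i x => v i (bz x)); split.
- by move=> i; have [v_gt0 sum_v _] := vP i; apply: (subprobability_part bxP).
- move=> i; have [v_gt0 sum_v _] := vP i; apply: (subprobability_part byP) => //.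
  by apply: le_trans sum_v; apply: ler_sum => j _; have [-> _] := sym.1 j.
- move=> i; have [v_gt0 sum_v _] := vP i; apply: (subprobability_part bzP) => //.
  by apply: le_trans sum_v; apply: ler_sum => j _; have [-> ->] := sym.1 j.
move=> I x y' z I_gt0 nz.
have [|p p_sym linp] := empirical_sym_distr R nonzero_blocks_rot
    (b := fun t => (bx (x t), by_ (y' t), bz (z t))) I_gt0.
  by move=> t; exact: (mem_nonzero_blocks (bxP _) (byP _) (bzP _) (nz t)).
have [i lt_i le_y] := cov_s _ p_sym; exists (Ordinal lt_i).
have [v_gt0 _ def_al] := vP (Ordinal lt_i); rewrite /= in def_al; rewrite def_al in le_y.
set vi := v _ in v_gt0 le_y *.
have := linp (fun j => - ln (vi j)) => /=.
rewrite !big_split /= !sumrN => linp'.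
have pos (J : I -> 'I_k) : 0 < \prod_t vi (J t) by apply: prodr_gt0.
rewrite -ler_ln ?posrE ?mulr_gt0 ?exprn_gt0 ?expR_gt0 //.
rewrite !lnM ?posrE ?mulr_gt0 ?exprn_gt0 ?expR_gt0 // !ln_prodr // ln1.
rewrite -expRM_natl expRK.
have : (3 * #|I|)%:R * (\sum_t - ln (vi t.1.1) * p t) <= (3 * #|I|)%:R * y.
  by rewrite ler_wpM2l.
rewrite linp'; lra.
Qed.

(** Any term of [T] would yield a symmetric distribution, its own symmetrised empirical one. So [T]
    has no term and the empty list of weights covers it. *)
Lemma weight_cover_no_distr :
  ~ (exists p : _ -> R, sym_distr L p) -> weight_cover T 0 (1 : R).
Proof.
move=> no_p; exists (fun _ _ => 1), (fun _ _ => 1), (fun _ _ => 1).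
split; try by case.
move=> I x y z I_gt0 nz; exfalso; apply: no_p.
have [bx bxP] := choice partX.1; have [by_ byP] := choice partY.1.
have [bz bzP] := choice partZ.1.
have [|p p_sym _] := empirical_sym_distr R nonzero_blocks_rot
    (b := fun t => (bx (x t), by_ (y t), bz (z t))) I_gt0.
  by move=> t; exact: (mem_nonzero_blocks (bxP _) (byP _) (bzP _) (nz t)).
by exists p.
Qed.

End Partitioned.

(** * Lower bounds on admissible exponents *)

Section Exponent.
Variables (R : realType) (F : fieldType) (X Y Z : finType) (T : tensor F X Y Z).
Variables (q n m : nat) (s : R) (a b c : 'I_m -> nat).
Hypotheses (s_gt0 : 0 < s) (n_gt0 : (0 < n)%N) (m_gt0 : (0 < m)%N).
Hypothesis abc_gt0 : forall i, [/\ (0 < a i)%N, (0 < b i)%N & (0 < c i)%N].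
Hypothesis cov : weight_cover T q s.
Hypothesis deg : degenerates (tensor_pow T n) (@mm_sum F m a b c).

Let N i : R := (a i * b i * c i)%:R.

Lemma abc_ge1 i : 1 <= N i.
Proof. by have [a0 b0 c0] := abc_gt0 i; rewrite /N (ler_nat R 1) !muln_gt0 a0 b0. Qed.

Lemma sum_abc_pow_le j : (0 < j)%N ->
  (\sum_i N i `^ (2 / 3)) ^+ j <= j.+1%:R ^+ m * (3 * q%:R * (s ^+ n) ^+ j).
Proof.
move=> j_gt0; pose rho i := N i `^ (1 / 3).
have N_ge0 i : 0 <= N i by exact: le_trans (abc_ge1 i).
have rhoX i d : rho i ^+ d = N i `^ (1 / 3 * d%:R).
  by rewrite -powR_mulrn ?powR_ge0 // -powRrM.
have -> : \sum_i N i `^ (2 / 3) = \sum_i rho i ^+ 2.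
  by apply: eq_bigr => i _; rewrite rhoX; congr (_ `^ _); lra.
apply: (sum_cuberoot_pow_le _ (weight_cover_pow n_gt0 cov) deg) => //.
- by rewrite exprn_gt0.
- by move=> i; rewrite powR_gt0 // (lt_le_trans _ (abc_ge1 i)).
- move=> i; rewrite rhoX (_ : 1 / 3 * 3%:R = 1); last by lra.
  by rewrite powRr1.
Qed.

Lemma sum_abc_ge1 : 1 <= \sum_i N i `^ (2 / 3).
Proof.
rewrite (bigD1 (Ordinal m_gt0)) //= -[leLHS]addr0; apply: lerD.
  by rewrite -[leLHS](powRr0 (N (Ordinal m_gt0))) ler_powR ?abc_ge1 //; lra.
by apply: sumr_ge0 => i _; exact: powR_ge0.
Qed.

(** With q = 0 the bound at j = 1 would put a sum that is at least 1 below 0. Hence no degeneration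
    exists when the weight cover is empty. *)
Lemma weights_nonempty : (0 < q)%N.
Proof.
rewrite lt0n; apply/eqP => q0; have := sum_abc_pow_le (ltn0Sn 0).
have := sum_abc_ge1; rewrite q0 mulr0 mul0r mulr0 expr1; lra.
Qed.

Lemma sum_abc_le : \sum_i N i `^ (2 / 3) <= s ^+ n.
Proof. by apply: le_of_subexp_growth sum_abc_pow_le; rewrite exprn_gt0. Qed.

(** Each y_i = N_i^(2/3) is at most S, as is their sum. Since w/2 - 1 >= 0, the power y_i^(w/2) is
    at most y_i S^(w/2 - 1), and summing gives S^(w/2). *)
Lemma sum_abc_powR_le (w : R) : 2 <= w ->
  \sum_i N i `^ (w / 3) <= (s ^+ n) `^ (w / 2).
Proof.
move=> w_ge2; set S := s ^+ n.
have S_gt0 : 0 < S by rewrite exprn_gt0.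
have y_gt0 i : 0 < N i `^ (2 / 3) by rewrite powR_gt0 // (lt_le_trans _ (abc_ge1 i)).
have yS i : N i `^ (2 / 3) <= S.
  apply: le_trans sum_abc_le; rewrite (bigD1 i) //= lerDl.
  by apply: sumr_ge0 => j _; exact: ltW.
have splitE (x : R) : 0 < x -> x `^ (w / 2) = x * x `^ (w / 2 - 1).
  move=> x0; rewrite -{2}(powRr1 (ltW x0)) -powRD; first by congr (_ `^ _); lra.
  by apply/implyP => _; rewrite gt_eqF.
rewrite splitE //.
apply: (@le_trans _ _ (\sum_i N i `^ (2 / 3) * S `^ (w / 2 - 1))).
  apply: ler_sum => i _; rewrite (_ : w / 3 = 2 / 3 * (w / 2)); last by lra.
  rewrite powRrM splitE // ler_pM2l //.
  by apply: ge0_ler_powR; rewrite ?nnegrE; [lra | exact: ltW | exact: ltW | exact: yS].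
by rewrite -mulr_suml ler_wpM2r ?powR_ge0 // sum_abc_le.
Qed.

Lemma exponent_ge (r w : R) : s < r -> \sum_i N i `^ (w / 3) = r ^+ n ->
  1 < s /\ 2 * ln r / ln s <= w.
Proof.
(* The previous bound needs an exponent of at least 2. If w were at most 2, then w' = 2 and the
   bound would read ln r <= ln s, against s < r; so w' = w. *)
move=> lt_sr def_r; pose w' := Num.max w 2.
have r_gt0 := lt_trans s_gt0 lt_sr.
have lt_ln : ln s < ln r by rewrite ltr_ln ?posrE.
have ln_s_ge0 : 0 <= ln s.
  have : 1 <= s ^+ n := le_trans sum_abc_ge1 sum_abc_le.
  by rewrite (expr_ge1 n_gt0 (ltW s_gt0)) => ?; exact: ln_ge0.
have le_r : r ^+ n <= (s ^+ n) `^ (w' / 2).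
  rewrite -def_r; apply: le_trans (sum_abc_powR_le _); last by rewrite le_max lexx orbT.
  apply: ler_sum => i _; apply: ler_powR; first exact: abc_ge1.
  by rewrite ler_pM2r ?le_max ?lexx.
have {le_r} le_r : ln r <= w' / 2 * ln s.
  move: le_r; rewrite -ler_ln ?posrE ?powR_gt0 ?exprn_gt0 // ln_powR !lnXn //.
  by rewrite -[ln r *+ n]mulr_natr -[ln s *+ n]mulr_natr mulrA ler_pM2r ?ltr0n.
have w'E : w' = w.
  rewrite /w'; case: (leP w 2) => [le_w2|lt_w2]; last by [].
  by move: le_r; rewrite /w' max_r // divff ?mul1r; lra.
rewrite w'E in le_r.
have ln_s_gt0 : 0 < ln s.
  rewrite lt_neqAle ln_s_ge0 andbT; apply/eqP => s0.
  by move: le_r; rewrite -s0 mulr0; lra.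
split; last by rewrite ler_pdivrMr //; lra.
by rewrite ltNge; apply/negP => /ln_le0; lra.
Qed.

End Exponent.

Theorem theorem1p2 (R : realType) (F : fieldType) (X Y Z : finType)
    (T : tensor F X Y Z) (k : nat)
    (PX : 'I_k -> {set X}) (PY : 'I_k -> {set Y}) (PZ : 'I_k -> {set Z})
    (T_minimal : tensor_minimal T)
    (partX : part_family PX) (partY : part_family PY)
    (partZ : part_family PZ)
    (T_laser_ready : laser_ready T PX PY PZ)
    (c : R) (c_gt2 : 2 < c)
    (laser_bound : forall p : 'I_k * 'I_k * 'I_k -> R,
      sym_distr (nonzero_blocks T PX PY PZ) p ->
      forall w : R, w < c ->
        laser_C (nonzero_blocks T PX PY PZ) p
          * laser_A (nonzero_blocks T PX PY PZ) PX p `^ (w / 2)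
        < asymptotic_rank R T) :
  (2%:E < omega_u R T)%E.
Proof.
have [_ _ [_ sym]] := T_laser_ready.
set r := asymptotic_rank R T in laser_bound *.
(* The infimum need not be attained, so a single bound above 2 must hold for all admissible w. *)
suff [w0 w0_gt2 w0_le] : exists2 w0 : R, 2 < w0 & forall w, universal_exponent T w -> w0 <= w.
  apply: (@lt_le_trans _ _ w0%:E); first by rewrite lte_fin.
  by apply: le_ereal_inf_tmp => _ [w /w0_le le_w <-]; rewrite lee_fin.
have [p_ex|no_p] := pselect (exists p : _ -> R, sym_distr (nonzero_blocks T PX PY PZ) p);
  last first.
  have cov := weight_cover_no_distr sym partX partY partZ no_p.
  (* No w is admissible here, and 3 is just some number above 2. *)
  exists 3; first by lra.
  move=> w [n [m [a [b [d [n_gt0 m_gt0 abd_gt0 deg _]]]]]]; exfalso.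
  by have := weights_nonempty ltr01 n_gt0 m_gt0 abd_gt0 cov deg; rewrite ltnn.
(* The hypothesis is taken at w = 2, which is allowed as c > 2; the strict inequality there leaves
   the slack that compactness makes uniform. *)
have laser2 p : sym_distr (nonzero_blocks T PX PY PZ) p ->
    laser_C (nonzero_blocks T PX PY PZ) p * laser_A (nonzero_blocks T PX PY PZ) PX p < r.
  move=> /laser_bound/(_ 2 c_gt2); rewrite divff // powRr1 //.
  by apply: prodr_ge0 => *; exact: powR_ge0.
have [q [s [s_gt0 lt_sr cov]]] := weight_cover_laser sym partX partY partZ laser2 p_ex.
have [s_gt1|s_le1] := ltP 1 s.
  exists (2 * ln r / ln s).
    have ln_s : 0 < ln s by exact: ln_gt0.
    have : ln s < ln r by rewrite ltr_ln ?posrE // (lt_trans s_gt0).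
    by rewrite ltr_pdivlMr // => ?; rewrite ltr_pM2l.
  move=> w [n [m [a [b [d [n_gt0 m_gt0 abd_gt0 deg def_r]]]]]].
  by have [] := exponent_ge s_gt0 n_gt0 m_gt0 abd_gt0 cov deg lt_sr def_r.
(* An admissible w would force 1 < s, so for s <= 1 there is none and any number above 2 will do. *)
exists 3; first by lra.
move=> w [n [m [a [b [d [n_gt0 m_gt0 abd_gt0 deg def_r]]]]]].
have [] := exponent_ge s_gt0 n_gt0 m_gt0 abd_gt0 cov deg lt_sr def_r.
by rewrite ltNge s_le1.
Qed.
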